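(* Suppose that (A1) $\|\mathbf B\|\le\kappa_B$ and $\|\mathbf w_t\|\le W$ for all $t$; (A2) every cost function $f_{i,t}$ is convex, and whenever $\|\mathbf x\|,\|\mathbf u\|\le D$ one has $\|\nabla_{\mathbf x}f_{i,t}(\mathbf x,\mathbf u)\|,\ \|\nabla_{\mathbf u}f_{i,t}(\mathbf x,\mathbf u)\|\le GD$; (A3) the zero policy $\mathbf K=0$ is $(\kappa,\gamma)$-diagonalizably stable for $(\mathbf A,\mathbf B)$. Run the D-OSC algorithm described in the context with hyper-parameters (with $\epsilon=1/\sqrt T$ and $d=d_1$) $$m=\Big\lceil \tfrac1\gamma\log\Big(\tfrac{8G\kappa_B\kappa^8W^2\sqrt T}{\gamma^3}\Big)\Big\rceil,\qquad h=\Big\lceil 2\log T\,\log\Big(\tfrac{600\,G\kappa_B\kappa^8W^2\sqrt{m d T}}{\gamma^{5/2}}\,\log T\,\log^{1/4}\big(\tfrac2\gamma\big)\Big)\Big\rceil,\qquad \eta=\frac{\gamma^2}{m h^2\sqrt T}.$$ Then for every agent $j\in[n]$, $$J_T^j-\min_{\mathbf K\in\mathcal S}J_T(\mathbf K)=\tilde O\Big(\frac{n\sqrt{nT}}{(1-\beta)\gamma^3}\Big),$$ where $\mathcal S$ is the set of $(\kappa,\gamma)$-diagonalizably stable linear policies, $J_T^j=\sum_{t=1}^T\sum_{i=1}^n f_{i,t}(\mathbf x_{j,t},\mathbf u_{j,t})$ is the network cost along agent $j$'s trajectory, and $J_T(\mathbf K)=\sum_{t=1}^T\sum_{i=1}^n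 f_{i,t}(\mathbf x_t^{\mathbf K},\mathbf u_t^{\mathbf K})$ is the cost of the linear policy $\mathbf u=\mathbf K\mathbf x$.
   Context: Norms: $\|\cdot\|$ is the Euclidean norm of vectors and the spectral norm of matrices; $[n]=\{1,\dots,n\}$. System: there are $n$ agents with identical known dynamics $\mathbf x_{i,t+1}=\mathbf A\mathbf x_{i,t}+\mathbf B\mathbf u_{i,t}+\mathbf w_t$, $i\in[n]$, with $\mathbf x_{i,t}\in\mathbb R^{d_1}$, $\mathbf u_{i,t}\in\mathbb R^{d_2}$, and arbitrary (adversarial) disturbances $\mathbf w_t\in\mathbb R^{d_1}$ common to all agents. Initial states are $\mathbf x_{i,1}=0$, and $\mathbf w_s=0$ for $s\le0$. At each time $t\in[T]$ agent $i$ receives a differentiable cost function $f_{i,t}:\mathbb R^{d_1}\times\mathbb R^{d_2}\to\mathbb R$. For a linear policy $\mathbf K\in\mathbb R^{d_2\times d_1}$: $\mathbf x^{\mathbf K}_1=0$, $\mathbf u^{\mathbf K}_t=\mathbf K\mathbf x^{\mathbf K}_t$, $\mathbf x^{\mathbf K}_{t+1}=\mathbf A\mathbf x^{\mathbf K}_t+\mathbf B\mathbf u_t^{\mathbf K}+\mathbf w_t$. Network: $\mathbf P\in\mathbb R^{n\times n}$ is a symmetric, doubly stochastic matrix with nonnegative entries and positive diagonal, whose associated undirected graph (edges $\{i,j\}$ with $[\mathbf P]_{ij}>0$) is connected; $\beta$ is its second largest singular value ($\beta=0$ if $n=1$). Diagonalizable stability: $\mathbf K$ is $(\kappa,\gamma)$-diagonalizably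 stable for $(\mathbf A,\mathbf B)$ if there are matrices $\mathbf L,\mathbf Q$ with $\mathbf A+\mathbf B\mathbf K=\mathbf Q\mathbf L\mathbf Q^{-1}$, $\mathbf L$ diagonal with nonnegative entries, $\|\mathbf L\|\le1-\gamma$, and $\|\mathbf K\|,\|\mathbf Q\|,\|\mathbf Q^{-1}\|\le\kappa$. Standing assumptions: $0<\gamma<2/3$ and $\kappa,\kappa_B,W>1$. Spectral controller: $\mathbf H\in\mathbb R^{m\times m}$ is the Hankel matrix $[\mathbf H]_{ij}=\frac{(1-\gamma)^{i+j-1}}{i+j-1}$, and $(\sigma_j,\phi_j)_{j=1}^h$ are its top $h$ eigenpairs, with orthonormal eigenvectors (convention: if $h>m$, terms with index $j>m$ are zero, i.e. $\sigma_j=0$). $\mathbf W_{t-1:t-m}=[\mathbf w_{t-1},\dots,\mathbf w_{t-m}]\in\mathbb R^{d_1\times m}$. For fixed parameters $\mathbf M_{1:h}=(\mathbf M_1,\dots,\mathbf M_h)$, $\mathbf M_j\in\mathbb R^{d_2\times d_1}$, let $\mathbf u_t(\mathbf M_{1:h})=\sum_{j=1}^h\sigma_j^{1/4}\mathbf M_j\mathbf W_{t-1:t-m}\phi_j$ and let $\mathbf x_t(\mathbf M_{1:h})$ be the state at time $t$ obtained by applying these controls at all times from the zero initial state. The memory-less cost is $f_{i,t}(\mathbf M_{1:h}\,|\,\mathbf A,\mathbf B,\{\mathbf w\})=f_{i,t}(\mathbf x_t(\mathbf M_{1:h}),\mathbf u_t(\mathbf M_{1:h}))$. Constraint set: $\mathcal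 K$ is the set of $\mathbf M_{1:h}$ with $\|\mathbf x_t(\mathbf M_{1:h})\|,\|\mathbf u_t(\mathbf M_{1:h})\|\le\frac{3\kappa^3W}{\gamma}$ for all $t\in[T]$ and $\|\mathbf M_{1:h}\|\le\kappa^3\sqrt{2h/\gamma}$, where $\|\mathbf M_{1:h}\|$ is the spectral norm of the concatenated matrix $[\mathbf M_1,\dots,\mathbf M_h]$. D-OSC algorithm (parameters $\eta,m,h$): all agents start from the same arbitrary $\mathbf M^{i,1}_{1:h}=\mathbf M^1_{1:h}\in\mathcal K$. For $t=1,\dots,T$, each agent $i$ plays $\mathbf u_{i,t}=\sum_{j=1}^h\sigma_j^{1/4}\mathbf M_j^{i,t}\mathbf W_{t-1:t-m}\phi_j$, observes $\mathbf x_{i,t+1}$, recovers $\mathbf w_t=\mathbf x_{i,t+1}-\mathbf A\mathbf x_{i,t}-\mathbf B\mathbf u_{i,t}$, computes $\widehat{\mathbf M}^{i,t+1}_{1:h}=\sum_{j=1}^n[\mathbf P]_{ji}\mathbf M^{j,t}_{1:h}-\eta\nabla_{\mathbf M}f_{i,t}(\mathbf M^{i,t}_{1:h}\,|\,\mathbf A,\mathbf B,\{\mathbf w\})$ and sets $\mathbf M^{i,t+1}_{1:h}=\Pi_{\mathcal K}(\widehat{\mathbf M}^{i,t+1}_{1:h})$, the Euclidean (Frobenius) projection onto $\mathcal K$. Asymptotic notation: $\tilde O(Y)$ means at most $C\,(\log T)^p\,Y$ for all sufficiently large $T$, where $p$ is an absolute constant and $C$ depends only on $G,\kappa,\kappa_B,W,d_1,d_2$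 (not on $T,n,\beta,\gamma,j$, the disturbances or the cost functions). *)

(* Defs.v *)
From mathcomp Require Export all_boot all_order all_algebra.
From mathcomp Require Export all_classical all_reals all_analysis.

Set Implicit Arguments.
Unset Strict Implicit.
Unset Printing Implicit Defensive.

Export Order.TTheory GRing.Theory Num.Theory.
Export numFieldNormedType.Exports.

Local Open Scope classical_set_scope.
Local Open Scope ring_scope.

(* Euclidean norm on column vectors, Frobenius norm on matrices.  The norm
   [`|_|] provided by MathComp-Analysis on matrices is the max norm. *)
Definition enorm (R : realType) (p q : nat) (X : 'M[R]_(p, q)) : R :=
  Num.sqrt (\sum_i \sum_j X i j ^+ 2).

Definition spectral_norm (R : realType) (p q : nat) (X : 'M[R]_(p, q)) : R :=
  sup [set enorm (X *m v) | v in [set v : 'cV[R]_q | enorm v <= 1]].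

(* Gradient with respect to a matrix (or, for q = 1, vector) argument, for the
   entrywise (Frobenius) inner product. *)
Definition gradient (R : realType) (p q : nat) (g : 'M[R]_(p, q) -> R)
    (X : 'M[R]_(p, q)) : 'M[R]_(p, q) :=
  \matrix_(i, j) 'D_(delta_mx i j) g X.

Definition gradx (R : realType) (d1 d2 : nat)
    (f : 'cV[R]_d1 * 'cV[R]_d2 -> R) (x : 'cV[R]_d1) (u : 'cV[R]_d2) :=
  gradient (fun y : 'cV[R]_d1 => f (y, u)) x.

Definition gradu (R : realType) (d1 d2 : nat)
    (f : 'cV[R]_d1 * 'cV[R]_d2 -> R) (x : 'cV[R]_d1) (u : 'cV[R]_d2) :=
  gradient (fun v : 'cV[R]_d2 => f (x, v)) u.

(* Singular values of a square matrix, with multiplicity, in nonincreasing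
   order: the square roots of the eigenvalues of P^T P. *)
Definition singular_values (R : realType) (n : nat) (P : 'M[R]_n) (s : seq R) :
    Prop :=
  [/\ sorted (fun a b => b <= a) s, all (fun a => 0 <= a) s &
      char_poly (P^T *m P) = \prod_(a <- s) ('X - (a ^+ 2)%:P)].

(* For n = 1 the default value of [nth] gives 0. *)
Definition second_singular_value (R : realType) (n : nat) (P : 'M[R]_n)
    (beta : R) : Prop :=
  exists2 s, singular_values P s & beta = nth 0 s 1.

Record gossip_matrix (R : realType) (n : nat) (P : 'M[R]_n) : Prop := {
  gossip_sym : P^T = P;
  gossip_ge0 : forall i j, 0 <= P i j;
  gossip_row : forall i, \sum_j P i j = 1;
  gossip_col : forall j, \sum_i P i j = 1;
  gossip_diag : forall i, 0 < P i i;
  gossip_connected : forall i j, connect (fun a b => 0 < P a b) i j }.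

Definition diag_stable (R : realType) (d1 d2 : nat) (A : 'M[R]_d1)
    (B : 'M[R]_(d1, d2)) (kappa gamma : R) (K : 'M[R]_(d2, d1)) : Prop :=
  exists L Q : 'M[R]_d1,
    [/\ Q \in unitmx, A + B *m K = Q *m L *m invmx Q,
        is_diag_mx L & forall i, 0 <= L i i] /\
    [/\ spectral_norm L <= 1 - gamma, spectral_norm K <= kappa,
        spectral_norm Q <= kappa & spectral_norm (invmx Q) <= kappa].

(* Time starts at 1; the value at index 0 is a dummy. *)
Fixpoint state (R : realType) (d1 d2 : nat) (A : 'M[R]_d1)
    (B : 'M[R]_(d1, d2)) (w : nat -> 'cV[R]_d1) (u : nat -> 'cV[R]_d2)
    (t : nat) {struct t} : 'cV[R]_d1 :=
  match t with
  | 0 => 0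
  | s.+1 => match s with
            | 0 => 0
            | _ => A *m state A B w u s + B *m u s + w s
            end
  end.

Fixpoint policy_state (R : realType) (d1 d2 : nat) (A : 'M[R]_d1)
    (B : 'M[R]_(d1, d2)) (w : nat -> 'cV[R]_d1) (K : 'M[R]_(d2, d1))
    (t : nat) {struct t} : 'cV[R]_d1 :=
  match t with
  | 0 => 0
  | s.+1 => match s with
            | 0 => 0
            | _ => let x := policy_state A B w K s in
                   A *m x + B *m (K *m x) + w s
            end
  end.

(* Indices are 0-based here, hence the exponent i + j + 1. *)
Definition hankel (R : realType) (gamma : R) (m : nat) : 'M[R]_m :=
  \matrix_(i, j) ((1 - gamma) ^+ (i + j + 1)%N / (i + j + 1)%N%:R).

(* (sigma 0, phi 0), (sigma 1, phi 1), ... is a full orthonormal eigensystem of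
   H in nonincreasing order, padded with sigma j = 0 for j >= m; its first h
   members are the top h eigenpairs. *)
Definition eigensystem (R : realType) (m : nat) (H : 'M[R]_m)
    (sigma : nat -> R) (phi : nat -> 'cV[R]_m) : Prop :=
  [/\ forall j, (j < m)%N -> H *m phi j = sigma j *: phi j,
      forall j k, (j < m)%N -> (k < m)%N ->
        (phi j)^T *m phi k = ((j == k)%:R)%:M,
      forall j k, (j <= k)%N -> (k < m)%N -> sigma k <= sigma j &
      forall j, (m <= j)%N -> sigma j = 0].

(* [w_{t-1}, ..., w_{t-m}], where w_s = 0 for s <= 0. *)
Definition window (R : realType) (d1 m : nat) (w : nat -> 'cV[R]_d1)
    (t : nat) : 'M[R]_(d1, m) :=
  \matrix_(a, k) (if (k.+1 < t)%N then w (t - k.+1)%N a 0 else 0).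

(* Parameters M_{1:h} are stored as the concatenated matrix [M_1, ..., M_h];
   [submxrow M j] is its j-th block. *)
Notation params R d1 d2 h := 'M[R]_(d2, (\sum_(j < h) d1)%N).

Definition block (R : realType) (d1 d2 h : nat) (M : params R d1 d2 h)
    (j : 'I_h) : 'M[R]_(d2, d1) := submxrow (q_ := fun=> d1) M j.

Definition spectral_control (R : realType) (d1 d2 m h : nat)
    (sigma : nat -> R) (phi : nat -> 'cV[R]_m) (w : nat -> 'cV[R]_d1)
    (M : params R d1 d2 h) (t : nat) : 'cV[R]_d2 :=
  \sum_(j < h) (sigma j `^ (1 / 4)) *: (block M j *m window m w t *m phi j).

Definition spectral_state (R : realType) (d1 d2 m h : nat) (A : 'M[R]_d1)
    (B : 'M[R]_(d1, d2)) (sigma : nat -> R) (phi : nat -> 'cV[R]_m)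
    (w : nat -> 'cV[R]_d1) (M : params R d1 d2 h) : nat -> 'cV[R]_d1 :=
  state A B w (spectral_control sigma phi w M).

Definition memoryless_cost (R : realType) (d1 d2 m h : nat) (A : 'M[R]_d1)
    (B : 'M[R]_(d1, d2)) (sigma : nat -> R) (phi : nat -> 'cV[R]_m)
    (f : 'cV[R]_d1 * 'cV[R]_d2 -> R) (t : nat) (w : nat -> 'cV[R]_d1)
    (M : params R d1 d2 h) : R :=
  f (spectral_state A B sigma phi w M t, spectral_control sigma phi w M t).

Definition constraint_set (R : realType) (d1 d2 m h : nat)
    (kappa W gamma : R) (T : nat) (A : 'M[R]_d1) (B : 'M[R]_(d1, d2))
    (sigma : nat -> R) (phi : nat -> 'cV[R]_m) (w : nat -> 'cV[R]_d1) :
    set (params R d1 d2 h) :=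
  [set M | (forall t, (1 <= t <= T)%N ->
              enorm (spectral_state A B sigma phi w M t)
                <= 3 * kappa ^+ 3 * W / gamma /\
              enorm (spectral_control sigma phi w M t)
                <= 3 * kappa ^+ 3 * W / gamma) /\
           spectral_norm M <= kappa ^+ 3 * Num.sqrt (2 * h%:R / gamma)].

Definition is_projection (R : realType) (p q : nat) (S : set 'M[R]_(p, q))
    (X Y : 'M[R]_(p, q)) : Prop :=
  S Y /\ forall Z, S Z -> enorm (X - Y) <= enorm (X - Z).

(* An execution of the algorithm on horizon T.  [M i t], [x i t], [u i t] are
   the parameters, state and control of agent i at time t, and [what i t] is
   the disturbance it recovers, the only one entering its controls and
   gradients. *)
Record dosc_run (R : realType) (n d1 d2 m h : nat) (eta : R)
    (S : set (params R d1 d2 h)) (T : nat)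
    (A : 'M[R]_d1) (B : 'M[R]_(d1, d2)) (P : 'M[R]_n)
    (sigma : nat -> R) (phi : nat -> 'cV[R]_m)
    (w : nat -> 'cV[R]_d1) (f : 'I_n -> nat -> 'cV[R]_d1 * 'cV[R]_d2 -> R)
    (M : 'I_n -> nat -> params R d1 d2 h)
    (x : 'I_n -> nat -> 'cV[R]_d1) (u : 'I_n -> nat -> 'cV[R]_d2)
    (what : 'I_n -> nat -> 'cV[R]_d1) : Prop := {
  dosc_M1 : exists2 M1, S M1 & forall i, M i 1%N = M1;
  dosc_x1 : forall i, x i 1%N = 0;
  dosc_control : forall i t, (1 <= t <= T)%N ->
    u i t = spectral_control sigma phi (what i) (M i t) t;
  dosc_dynamics : forall i t, (1 <= t <= T)%N ->
    x i t.+1 = A *m x i t + B *m u i t + w t;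
  dosc_recover : forall i t, (1 <= t <= T)%N ->
    what i t = x i t.+1 - A *m x i t - B *m u i t;
  dosc_update : forall i t, (1 <= t <= T)%N ->
    is_projection S
      (\sum_j P j i *: M j t
       - eta *: gradient (memoryless_cost A B sigma phi (f i t) t (what i))
                  (M i t))
      (M i t.+1) }.

(* The ceilings below are of positive reals as soon as T is large, so that the
   absolute value only serves as the conversion from int to nat. *)
Definition dosc_m (R : realType) (G kappaB kappa W gamma : R) (T : nat) : nat :=
  `|Num.ceil (gamma^-1 *
      ln (8 * G * kappaB * kappa ^+ 8 * W ^+ 2 * Num.sqrt T%:R
          / gamma ^+ 3))|%N.

Definition dosc_h (R : realType) (G kappaB kappa W gamma : R) (d T : nat) :
    nat :=
  let m := dosc_m G kappaB kappa W gamma T in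
  `|Num.ceil (2 * ln (T%:R : R) *
      ln (600 * G * kappaB * kappa ^+ 8 * W ^+ 2 * Num.sqrt (m * d * T)%N%:R
          / (gamma `^ (5 / 2)) * ln T%:R * (ln (2 / gamma) `^ (1 / 4))))|%N.

Definition dosc_eta (R : realType) (gamma : R) (m h T : nat) : R :=
  gamma ^+ 2 / (m%:R * h%:R ^+ 2 * Num.sqrt T%:R).

Definition agent_cost (R : realType) (n d1 d2 : nat) (T : nat)
    (f : 'I_n -> nat -> 'cV[R]_d1 * 'cV[R]_d2 -> R)
    (x : nat -> 'cV[R]_d1) (u : nat -> 'cV[R]_d2) : R :=
  \sum_(1 <= t < T.+1) \sum_(i < n) f i t (x t, u t).

Definition policy_cost (R : realType) (n d1 d2 : nat) (T : nat)
    (A : 'M[R]_d1) (B : 'M[R]_(d1, d2)) (w : nat -> 'cV[R]_d1)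
    (f : 'I_n -> nat -> 'cV[R]_d1 * 'cV[R]_d2 -> R) (K : 'M[R]_(d2, d1)) : R :=
  agent_cost T f (policy_state A B w K)
    (fun t => K *m policy_state A B w K t).

(* Main.v *)
(* Once [log T] exceeds every quantity depending on gamma and the other
   constants, [h] exceeds [m]: the filters phi_0, ..., phi_(m-1) form a complete
   orthonormal basis, and no decay of the Hankel spectrum is needed.

   A diagonalizably stable policy [K], with [A + B K = Q L Q^-1], is reproduced
   up to truncation of its impulse response after [m] steps by the parameters
   [M_j = sigma_j^(-1/4) K Q p_j(L) Q^-1], where [p_j] is the polynomial with
   coefficient vector phi_j.  They are feasible because
   [|p_j| <= (2 / gamma) sigma_j^(1/4)] on [0, 1 - gamma].

   Against this comparator, the regret is that of projected gradient descent
   with gossip.  Averaging contracts disagreement by the factor beta < 1, so the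
   agents stay within [O(eta sqrt n / (1 - beta))] of their mean and move slowly;
   by stability, the true state then stays close to the memoryless one. *)

From HB Require Import structures.
Require Import Defs.
From mathcomp Require Import ring lra.
From mathcomp Require polyrcf spectral complex.

Set Implicit Arguments.
Unset Strict Implicit.
Unset Printing Implicit Defensive.

Local Open Scope classical_set_scope.
Local Open Scope ring_scope.

(** * Euclidean and spectral norms *)

(** The threshold on [T] may depend on [gamma] and on all fixed constants, so each of them is simply
    counted as one power of [ln T]. The number of agents and [beta] are quantified after [T] and
    cannot be absorbed: only [sqrt n / (1 - beta)] and [sqrt T] are tracked with care, and crude
    estimates do for the rest. Two mismatches separate the algorithm from online gradient descent.
    Agent [j] is charged every [f i], while only agent [i] differentiates [f i], at its own
    parameters; and a true state carries the parameters of all past rounds, while the memoryless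
    cost uses the current ones throughout. Both are settled by one estimate, of [M j s] against
    [M i t]: the gap is linear in [t - s], and stable dynamics sum such a forcing at the price of
    [1 / gamma ^ 2]. The exponent 1/4 has this origin: Hankel entries are integrals of [x ^ (i + j)]
    over [0, 1 - gamma], so [sigma_j] is the squared L2 norm of [p_j], and a bound on [p_j'] turns
    it into a sup bound by the fourth root of [sigma_j]. The step [eta], of order [1 / sqrt T],
    balances the initial distance over [eta] against [T * eta]. *)

Section Norms.
Variable R : realType.

Definition fdot p q (X Y : 'M[R]_(p, q)) : R := \sum_i \sum_j X i j * Y i j.

Lemma fdotC p q (X Y : 'M[R]_(p, q)) : fdot X Y = fdot Y X.
Proof. by apply: eq_bigr => i _; apply: eq_bigr => j _; rewrite mulrC. Qed.

Lemma fdotDl p q (X Y Z : 'M[R]_(p, q)) : fdot (X + Y) Z = fdot X Z + fdot Y Z.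
Proof.
rewrite -big_split; apply: eq_bigr => i _; rewrite -big_split.
by apply: eq_bigr => j _; rewrite mxE mulrDl.
Qed.

Lemma fdotZl p q a (X Z : 'M[R]_(p, q)) : fdot (a *: X) Z = a * fdot X Z.
Proof.
rewrite mulr_sumr; apply: eq_bigr => i _; rewrite mulr_sumr.
by apply: eq_bigr => j _; rewrite mxE mulrA.
Qed.

Lemma fdotNl p q (X Z : 'M[R]_(p, q)) : fdot (- X) Z = - fdot X Z.
Proof. by rewrite -scaleN1r fdotZl mulN1r. Qed.

Lemma fdotBl p q (X Y Z : 'M[R]_(p, q)) : fdot (X - Y) Z = fdot X Z - fdot Y Z.
Proof. by rewrite fdotDl fdotNl. Qed.

Lemma fdotDr p q (X Y Z : 'M[R]_(p, q)) : fdot Z (X + Y) = fdot Z X + fdot Z Y.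
Proof. by rewrite fdotC fdotDl !(fdotC Z). Qed.

Lemma fdotZr p q a (X Z : 'M[R]_(p, q)) : fdot Z (a *: X) = a * fdot Z X.
Proof. by rewrite fdotC fdotZl (fdotC Z). Qed.

Lemma fdotBr p q (X Y Z : 'M[R]_(p, q)) : fdot Z (X - Y) = fdot Z X - fdot Z Y.
Proof. by rewrite fdotC fdotBl !(fdotC Z). Qed.

Lemma fdot0l p q (Z : 'M[R]_(p, q)) : fdot 0 Z = 0.
Proof. by rewrite -(scale0r 0) fdotZl mul0r. Qed.

Lemma fdot_ge0 p q (X : 'M[R]_(p, q)) : 0 <= fdot X X.
Proof. by do 2!(apply: sumr_ge0 => ? _); rewrite -expr2 sqr_ge0. Qed.

Lemma enorm_ge0 p q (X : 'M[R]_(p, q)) : 0 <= enorm X.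
Proof. exact: sqrtr_ge0. Qed.

Lemma sqr_enorm p q (X : 'M[R]_(p, q)) : enorm X ^+ 2 = fdot X X.
Proof.
rewrite sqr_sqrtr; first by do 2!(apply: eq_bigr => ? _).
by do 2!(apply: sumr_ge0 => ? _); rewrite sqr_ge0.
Qed.

Lemma sqr_enormE p q (X : 'M[R]_(p, q)) :
  enorm X ^+ 2 = \sum_i \sum_j X i j ^+ 2.
Proof. by rewrite sqr_enorm; do 2!(apply: eq_bigr => ? _). Qed.

Lemma enorm_eq0 p q (X : 'M[R]_(p, q)) : enorm X = 0 -> X = 0.
Proof.
move=> X0; have : enorm X ^+ 2 = 0 by rewrite X0 expr0n.
rewrite sqr_enormE => /eqP; rewrite psumr_eq0 => [/allP /= H|i _]; last first.
  by apply: sumr_ge0 => j _; rewrite sqr_ge0.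
apply/matrixP => i j; rewrite mxE.
have := H i (mem_index_enum i); rewrite psumr_eq0 => [/allP /= Hi|k _].
  by have := Hi j (mem_index_enum j); rewrite sqrf_eq0 => /eqP.
by rewrite sqr_ge0.
Qed.

Lemma enorm0 p q : enorm (0 : 'M[R]_(p, q)) = 0.
Proof.
by apply/eqP; rewrite -sqrf_eq0 sqr_enorm fdot0l.
Qed.

Lemma cauchy_schwarz p q (X Y : 'M[R]_(p, q)) : fdot X Y <= enorm X * enorm Y.
Proof.
have [X0|X0] := eqVneq (enorm X) 0.
  by rewrite (enorm_eq0 X0) fdot0l enorm0 mul0r.
have X_gt0 : 0 < enorm X by rewrite lt_def X0 enorm_ge0.
have [Y0|Y0] := eqVneq (enorm Y) 0.
  by rewrite (enorm_eq0 Y0) fdotC fdot0l enorm0 mulr0.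
have Y_gt0 : 0 < enorm Y by rewrite lt_def Y0 enorm_ge0.
(* This square expands to twice [enorm X * enorm Y] times the gap in the inequality. *)
have := fdot_ge0 (enorm Y *: X - enorm X *: Y).
rewrite !(fdotBl, fdotBr, fdotZl, fdotZr) -!sqr_enorm (fdotC Y X) => H.
have : 0 <= enorm X * enorm Y * (enorm X * enorm Y - fdot X Y) by nra.
by rewrite pmulr_rge0 ?mulr_gt0// subr_ge0.
Qed.

Lemma enormD p q (X Y : 'M[R]_(p, q)) : enorm (X + Y) <= enorm X + enorm Y.
Proof.
rewrite -(@ler_pXn2r _ 2) ?nnegrE ?addr_ge0 ?enorm_ge0// sqr_enorm.
rewrite !(fdotDl, fdotDr) -!sqr_enorm (fdotC Y X).
have := cauchy_schwarz X Y; nra.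
Qed.

Lemma enormZ p q a (X : 'M[R]_(p, q)) : enorm (a *: X) = `|a| * enorm X.
Proof.
apply/eqP; rewrite -(@eqrXn2 _ 2) ?mulr_ge0 ?enorm_ge0// exprMn !sqr_enorm.
by rewrite fdotZl fdotZr real_normK ?num_real// mulrA expr2.
Qed.

Lemma sqr_enormB p q (X Y : 'M[R]_(p, q)) :
  enorm (X - Y) ^+ 2 = enorm X ^+ 2 - 2 * fdot X Y + enorm Y ^+ 2.
Proof. by rewrite !sqr_enorm !(fdotBl, fdotBr) (fdotC Y X); ring. Qed.

Lemma enormN p q (X : 'M[R]_(p, q)) : enorm (- X) = enorm X.
Proof. by rewrite -scaleN1r enormZ normrN1 mul1r. Qed.

Lemma enormB p q (X Y : 'M[R]_(p, q)) : enorm (X - Y) = enorm (Y - X).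
Proof. by rewrite -enormN opprB. Qed.

Lemma enorm_sum (I : Type) (r : seq I) (Pr : pred I) p q (F : I -> 'M[R]_(p, q)) :
  enorm (\sum_(i <- r | Pr i) F i) <= \sum_(i <- r | Pr i) enorm (F i).
Proof.
elim/big_ind2: _ => [|x a y b xa yb|//]; first by rewrite enorm0.
by apply: le_trans (enormD _ _) _; exact: lerD.
Qed.

Lemma enorm_tr p q (X : 'M[R]_(p, q)) : enorm X^T = enorm X.
Proof.
rewrite /enorm exchange_big; congr Num.sqrt.
by apply: eq_bigr => i _; apply: eq_bigr => j _; rewrite mxE.
Qed.

Lemma sqr_enorm_col p q (X : 'M[R]_(p, q)) :
  enorm X ^+ 2 = \sum_j enorm (col j X) ^+ 2.
Proof.
rewrite sqr_enormE exchange_big; apply: eq_bigr => j _.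
by rewrite sqr_enormE; apply: eq_bigr => i _; rewrite big_ord1 mxE.
Qed.

Lemma sqr_enorm_row p q (X : 'M[R]_(p, q)) :
  enorm X ^+ 2 = \sum_i enorm (row i X) ^+ 2.
Proof.
rewrite sqr_enormE; apply: eq_bigr => j _.
by rewrite sqr_enormE big_ord1; apply: eq_bigr => i _; rewrite mxE.
Qed.

Lemma entry_le_enorm p q (X : 'M[R]_(p, q)) i j : `|X i j| <= enorm X.
Proof.
rewrite -(@ler_pXn2r _ 2) ?nnegrE ?enorm_ge0// real_normK ?num_real//.
rewrite sqr_enormE (bigD1 i)//= (bigD1 j)//=.
rewrite -addrA lerDl addr_ge0//; first by apply: sumr_ge0 => k _; rewrite sqr_ge0.
by do 2!(apply: sumr_ge0 => ? _); rewrite sqr_ge0.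
Qed.

Lemma enormM p q r (X : 'M[R]_(p, q)) (Y : 'M[R]_(q, r)) :
  enorm (X *m Y) <= enorm X * enorm Y.
Proof.
rewrite -(@ler_pXn2r _ 2) ?nnegrE ?mulr_ge0 ?enorm_ge0// exprMn.
rewrite sqr_enormE (sqr_enorm_row X) mulr_suml; apply: ler_sum => i _.
rewrite (sqr_enorm_col Y) mulr_sumr; apply: ler_sum => j _.
rewrite -exprMn -[leLHS]real_normK ?num_real// ler_pXn2r ?nnegrE ?mulr_ge0 ?enorm_ge0//.
have -> : (X *m Y) i j = fdot (row i X)^T (col j Y).
  by rewrite mxE; apply: eq_bigr => k _; rewrite big_ord1 !mxE.
rewrite -(enorm_tr (row i X)) ler_norml cauchy_schwarz andbT lerNl.
by rewrite -fdotNl -(enormN (row i X)^T) cauchy_schwarz.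
Qed.

Lemma enorm_le_entries p q (X : 'M[R]_(p, q)) (a : R) : 0 <= a ->
  (forall i j, `|X i j| <= a) -> enorm X <= Num.sqrt (p * q)%:R * a.
Proof.
move=> a0 Xa; rewrite -(@ler_pXn2r _ 2) ?nnegrE ?mulr_ge0 ?enorm_ge0 ?sqrtr_ge0//.
rewrite sqr_enormE exprMn sqr_sqrtr ?ler0n//.
apply: (@le_trans _ _ (\sum_(i < p) \sum_(j < q) a ^+ 2)).
  apply: ler_sum => i _; apply: ler_sum => j _.
  by rewrite -[leLHS]real_normK ?num_real// ler_pXn2r ?nnegrE.
by rewrite !sumr_const !card_ord -!mulrnA mulr_natl mulnC.
Qed.

Lemma spectral_norm_has_sup p q (X : 'M[R]_(p, q)) :
  has_sup [set enorm (X *m v) | v in [set v : 'cV[R]_q | enorm v <= 1]].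
Proof.
split; first by exists (enorm (X *m (0 : 'cV[R]_q))), 0 => //=; rewrite enorm0 ler01.
exists (enorm X) => _ [v /= v1 <-]; apply: le_trans (enormM _ _) _.
by rewrite ler_piMr ?enorm_ge0.
Qed.

Lemma spectral_norm_ge0 p q (X : 'M[R]_(p, q)) : 0 <= spectral_norm X.
Proof.
apply: le_trans (ub_le_sup (spectral_norm_has_sup X).2 _) => /=; last first.
  by exists (0 : 'cV[R]_q) => //=; rewrite enorm0 ler01.
exact: enorm_ge0.
Qed.

Lemma spectral_norm_mul p q (X : 'M[R]_(p, q)) (v : 'cV[R]_q) :
  enorm (X *m v) <= spectral_norm X * enorm v.
Proof.
have [v0|v0] := eqVneq (enorm v) 0.
  by rewrite (enorm_eq0 v0) mulmx0 !enorm0 mulr0.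
have v_gt0 : 0 < enorm v by rewrite lt_def v0 enorm_ge0.
rewrite -ler_pdivrMr// mulrC.
have -> : (enorm v)^-1 * enorm (X *m v) = enorm (X *m ((enorm v)^-1 *: v)).
  by rewrite -scalemxAr enormZ ger0_norm// invr_ge0 enorm_ge0.
apply: ub_le_sup; first exact: (spectral_norm_has_sup X).2.
exists ((enorm v)^-1 *: v) => //=.
by rewrite enormZ ger0_norm ?invr_ge0 ?enorm_ge0// mulVf.
Qed.

Lemma spectral_norm_leP p q (X : 'M[R]_(p, q)) (c : R) : 0 <= c ->
  (forall v : 'cV[R]_q, enorm (X *m v) <= c * enorm v) <-> spectral_norm X <= c.
Proof.
move=> c0; split=> [H|H v]; last first.
  by apply: le_trans (spectral_norm_mul _ _) _; rewrite ler_wpM2r ?enorm_ge0.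
apply: ge_sup; first exact: (spectral_norm_has_sup X).1.
by move=> _ [v /= v1 <-]; apply: le_trans (H v) _; rewrite ler_piMr.
Qed.

Lemma spectral_norm_le_enorm p q (X : 'M[R]_(p, q)) : spectral_norm X <= enorm X.
Proof. by apply/spectral_norm_leP => [|v]; [exact: enorm_ge0|exact: enormM]. Qed.

Lemma enorm_delta_mx q (j : 'I_q) : enorm (delta_mx j 0 : 'cV[R]_q) = 1.
Proof.
apply/eqP; rewrite -(@eqrXn2 _ 2) ?enorm_ge0// expr1n sqr_enormE.
rewrite (bigD1 j)//= big_ord1 mxE !eqxx expr1n big1 ?addr0// => i ij.
by rewrite big_ord1 mxE (negPf ij) expr0n.
Qed.

(** Each column is the image of a unit basis vector. Through this bound the spectral constraint on
    the parameters controls Frobenius distances, at the price of the root of the number of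
    columns. *)
Lemma enorm_le_spectral_norm p q (X : 'M[R]_(p, q)) :
  enorm X <= Num.sqrt q%:R * spectral_norm X.
Proof.
rewrite -(@ler_pXn2r _ 2) ?nnegrE ?mulr_ge0 ?enorm_ge0 ?sqrtr_ge0 ?spectral_norm_ge0//.
rewrite sqr_enorm_col exprMn sqr_sqrtr ?ler0n//.
apply: (@le_trans _ _ (\sum_(j < q) spectral_norm X ^+ 2)); last first.
  by rewrite sumr_const card_ord mulr_natl.
apply: ler_sum => j _; rewrite ler_pXn2r ?nnegrE ?enorm_ge0 ?spectral_norm_ge0//.
rewrite colE; apply: le_trans (spectral_norm_mul _ _) _.
by rewrite enorm_delta_mx mulr1.
Qed.

Lemma spectral_norm_convex p q (X Y : 'M[R]_(p, q)) (a b c : R) :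
  0 <= a -> 0 <= b -> a + b = 1 -> spectral_norm X <= c -> spectral_norm Y <= c ->
  spectral_norm (a *: X + b *: Y) <= c.
Proof.
move=> a0 b0 ab1 Xc Yc; have c0 := le_trans (spectral_norm_ge0 X) Xc.
apply/spectral_norm_leP => // v; rewrite mulmxDl -!scalemxAl.
apply: le_trans (enormD _ _) _; rewrite !enormZ !ger0_norm//.
have /spectral_norm_leP := Xc => /(_ c0 v) HX.
have /spectral_norm_leP := Yc => /(_ c0 v) HY.
have -> : c * enorm v = a * (c * enorm v) + b * (c * enorm v).
  by rewrite -mulrDl ab1 mul1r.
by apply: lerD; rewrite ler_wpM2l.
Qed.

Lemma enorm_convex p q (X Y : 'M[R]_(p, q)) (a b c : R) :
  0 <= a -> 0 <= b -> a + b = 1 -> enorm X <= c -> enorm Y <= c ->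
  enorm (a *: X + b *: Y) <= c.
Proof.
move=> a0 b0 ab1 Xc Yc; apply: le_trans (enormD _ _) _.
rewrite !enormZ !ger0_norm//; have -> : c = a * c + b * c by rewrite -mulrDl ab1 mul1r.
by apply: lerD; rewrite ler_wpM2l.
Qed.

End Norms.

(** * Stable linear dynamics *)

Section Stability.
Variable R : realType.

(** In the coordinates [invmx Q *m x] the transition is [L], which contracts by [1 - gamma], so a
    scalar supersolution [rho] dominates the norm. One [kappa] is paid for [invmx Q] on the forcing,
    the other for [Q] on the way back. Free [b] and [rho] serve both constant and growing
    forcing. *)
Lemma stable_comparison d (F L Q : 'M[R]_d) (kappa gamma : R) t
    (x e : nat -> 'cV[R]_d) (b rho : nat -> R) :
  Q \in unitmx -> F = Q *m L *m invmx Q ->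
  spectral_norm L <= 1 - gamma -> spectral_norm Q <= kappa ->
  spectral_norm (invmx Q) <= kappa ->
  x 1%N = 0 -> (forall s, (1 <= s < t)%N -> x s.+1 = F *m x s + e s) ->
  (forall s, (1 <= s < t)%N -> enorm (e s) <= b s) -> 0 <= rho 1%N ->
  (forall s, (1 <= s < t)%N -> (1 - gamma) * rho s + kappa * b s <= rho s.+1) ->
  forall s, (1 <= s <= t)%N -> enorm (x s) <= kappa * rho s.
Proof.
move=> uQ FE Lg Qk Qk' x1 xS eb rho1 rhoS.
have k_ge0 := le_trans (spectral_norm_ge0 Q) Qk.
have L_ge0 := le_trans (spectral_norm_ge0 L) Lg.
have bnd (X : 'M[R]_d) (v : 'cV[R]_d) c : 0 <= c -> spectral_norm X <= c ->
    enorm (X *m v) <= c * enorm v.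
  by move=> c0 /spectral_norm_leP; exact.
have H s : (1 <= s <= t)%N -> enorm (invmx Q *m x s) <= rho s.
  elim: s => [//|[|s] IH /andP[_ st]]; first by rewrite x1 mulmx0 enorm0.
  have s1 : (1 <= s.+1 < t)%N by [].
  apply: le_trans (rhoS _ s1); rewrite xS// mulmxDr FE !mulmxA mulVmx// mul1mx.
  apply: le_trans (enormD _ _) _; apply: lerD.
    rewrite -mulmxA; apply: le_trans (bnd _ _ _ L_ge0 Lg) _.
    by rewrite ler_wpM2l// IH//= ltnW.
  by apply: le_trans (bnd _ _ _ k_ge0 Qk') _; rewrite ler_wpM2l// eb.
move=> s st; rewrite -[x s](mulKVmx uQ).
by apply: le_trans (bnd _ _ _ k_ge0 Qk) _; rewrite ler_wpM2l// H.
Qed.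

(** For constant forcing, [kappa * b / gamma] is the fixed point of the scalar recursion. *)
Lemma stable_bounded d1 d2 (A : 'M[R]_d1) (B : 'M[R]_(d1, d2)) (kappa gamma : R)
    (K : 'M[R]_(d2, d1)) t (x e : nat -> 'cV[R]_d1) (b : R) :
  0 < gamma -> diag_stable A B kappa gamma K ->
  x 1%N = 0 -> (forall s, (1 <= s < t)%N -> x s.+1 = (A + B *m K) *m x s + e s) ->
  (forall s, (1 <= s < t)%N -> enorm (e s) <= b) -> 0 <= b -> (1 <= t)%N ->
  enorm (x t) <= kappa ^+ 2 * b / gamma.
Proof.
move=> g0 [L [Q [[uQ FE _ _] [Lg _ Qk Qk']]]] x1 xS eb b0 t1.
have k_ge0 := le_trans (spectral_norm_ge0 Q) Qk.
have -> : kappa ^+ 2 * b / gamma = kappa * (kappa * b / gamma) by ring.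
apply: (@stable_comparison _ (A + B *m K) L Q _ gamma t _ e (fun=> b) (fun=> kappa *
  b / gamma)) => //.
- by rewrite /= divr_ge0 ?mulr_ge0// ltW.
- move=> s _; suff -> : (1 - gamma) * (kappa * b / gamma) + kappa * b = kappa * b /
  gamma by [].
  by field; rewrite gt_eqF.
- by rewrite t1 leqnn.
Qed.

(* The forcing may grow linearly with the delay [t - s], at the cost of one
   more factor [1 / gamma]. *)
Lemma stable_drift d1 d2 (A : 'M[R]_d1) (B : 'M[R]_(d1, d2)) (kappa gamma : R)
    (K : 'M[R]_(d2, d1)) t (x e : nat -> 'cV[R]_d1) (c : R) :
  0 < gamma -> gamma <= 1 -> diag_stable A B kappa gamma K ->
  x 1%N = 0 -> (forall s, (1 <= s < t)%N -> x s.+1 = (A + B *m K) *m x s + e s) ->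
  (forall s, (1 <= s < t)%N -> enorm (e s) <= c * (t.+1 - s)%:R) -> 0 <= c ->
  (1 <= t)%N -> enorm (x t) <= 2 * kappa ^+ 2 * c / gamma ^+ 2.
Proof.
move=> g0 g1 [L [Q [[uQ FE _ _] [Lg _ Qk Qk']]]] x1 xS eb c0 t1.
have k_ge0 := le_trans (spectral_norm_ge0 Q) Qk.
(* The affine function of the delay that solves the recursion with equality; [gamma ^- 2]
   compensates its slope. At [s = t] the delay is 1, and both terms are at most [gamma ^- 2], whence
   the factor 2. *)
pose rho s := kappa * c * ((t.+1 - s)%:R / gamma + gamma ^- 2).
have kc0 : 0 <= kappa * c by rewrite mulr_ge0.
apply: (@le_trans _ _ (kappa * rho t)).
  apply: (@stable_comparison _ (A + B *m K) L Q _ gamma t _ e (fun s => c * (t.+1 -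
    s)%:R) rho) => //.
  - rewrite /rho mulr_ge0// addr_ge0 ?invr_ge0 ?sqr_ge0//.
    by rewrite divr_ge0// ltW.
  - move=> s /andP[_ st]; rewrite /rho subSS subSn 1?ltnW// -natr1.
    set y := (t - s)%:R.
    suff -> : (1 - gamma) * (kappa * c * ((y + 1) / gamma + gamma ^- 2)) + kappa * (c
      * (y + 1)) = kappa * c * (y / gamma + gamma ^- 2) by [].
    by field; rewrite gt_eqF.
  - by rewrite t1 leqnn.
rewrite /rho subSn// subnn.
have -> : 2 * kappa ^+ 2 * c / gamma ^+ 2 = kappa * (kappa * c) * (2 * gamma ^- 2) by
  ring.
rewrite mulrA; apply: ler_wpM2l; first by rewrite mulr_ge0.
have : gamma^-1 <= gamma ^- 2.
  by rewrite lef_pV2 ?posrE ?exprn_gt0// expr2 ler_piMr// ltW.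
by rewrite mul1r; lra.
Qed.

End Stability.

(** * Eigenvectors of the Hankel matrix *)

Section Hankel.
Import polyrcf.
Variable R : realType.

Lemma geometric_le (x : R) m : 0 <= x -> x < 1 ->
  \sum_(k < m) x ^+ k <= (1 - x)^-1.
Proof.
move=> x0 x1; rewrite -[leRHS]mul1r ler_pdivlMr ?subr_gt0// mulrC.
suff -> : (1 - x) * \sum_(k < m) x ^+ k = 1 - x ^+ m.
  by rewrite lerBlDr lerDl exprn_ge0.
elim: m => [|m IH]; first by rewrite big_ord0 mulr0 expr0 subrr.
by rewrite big_ord_recr /= mulrDr IH exprS; ring.
Qed.

(** Multiplication by [1 - x] turns the sum into a geometric one minus a nonnegative boundary
    term. *)
Lemma arithgeometric_le (x : R) m : 0 <= x -> x < 1 ->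
  \sum_(k < m) k%:R * x ^+ k.-1 <= (1 - x) ^- 2.
Proof.
move=> x0 x1; have y0 : 0 < 1 - x by rewrite subr_gt0.
case: m => [|m]; first by rewrite big_ord0 invr_ge0 sqr_ge0.
suff H : (1 - x) * \sum_(k < m.+1) k%:R * x ^+ k.-1 =
    \sum_(k < m) x ^+ k - m%:R * x ^+ m.
  rewrite expr2 invfM ler_pdivlMr// mulrC H.
  rewrite lerBlDr (le_trans (geometric_le _ x0 x1))// lerDl mulr_ge0// exprn_ge0//.
elim: m => [|m IH]; first by rewrite big_ord_recr !big_ord0 /= !mul0r addr0 mulr0 subrr.
rewrite big_ord_recr /= mulrDr IH [in RHS]big_ord_recr /= exprS -natr1; ring.
Qed.

Variables (gamma : R) (m : nat) (phi : 'cV[R]_m) (sigma : R).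
Hypotheses (g_gt0 : 0 < gamma) (g_lt : gamma < 2 / 3).
Hypothesis phi_eigen : hankel gamma m *m phi = sigma *: phi.
Hypothesis phi_unit : phi^T *m phi = 1%:M.

Definition filter_poly : {poly R} := \sum_k phi k 0 *: 'X^k.
Local Notation p := filter_poly.

Lemma filter_polyE x : p.[x] = \sum_k phi k 0 * x ^+ k.
Proof.
by rewrite horner_sum; apply: eq_bigr => k _; rewrite hornerZ hornerXn.
Qed.

(** The antiderivative of [p ^+ 2] that vanishes at 0, written termwise. Its coefficients are those
    of the Hankel form, so its value at [1 - gamma] is [phi^T H phi = sigma]; integrals are thus
    replaced by increments of a polynomial. *)
Let F : {poly R} :=
  \sum_i \sum_j (phi i 0 * phi j 0 / (i + j + 1)%N%:R) *: 'X^(i + j + 1).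

Let deriv_F : F^`() = p ^+ 2.
Proof.
rewrite expr2 /filter_poly mulr_suml raddf_sum; apply: eq_bigr => i _ /=.
rewrite raddf_sum mulr_sumr; apply: eq_bigr => j _ /=.
rewrite derivZ derivXn addn1 /= -scalerMnr scalerMnl -mulr_natr mulfVK ?pnatr_eq0//.
by rewrite -scalerAl -scalerAr scalerA exprD.
Qed.

Let F0 : F.[0] = 0.
Proof.
rewrite horner_sum big1// => i _; rewrite horner_sum big1// => j _.
by rewrite hornerZ hornerXn addn1 expr0n mulr0.
Qed.

Let F1 : F.[1 - gamma] = sigma.
Proof.
have : (phi^T *m (hankel gamma m *m phi)) 0 0 = sigma.
  by rewrite phi_eigen -scalemxAr phi_unit !mxE eqxx mulr1.
move=> <-; rewrite horner_sum mxE; apply: eq_bigr => i _.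
rewrite horner_sum !mxE mulr_sumr; apply: eq_bigr => j _.
by rewrite !mxE hornerZ hornerXn; ring.
Qed.

Let phi_le1 k : `|phi k 0| <= 1.
Proof.
apply: le_trans (entry_le_enorm _ _ _) _; rewrite -(@expr_le1 _ 2) ?enorm_ge0//.
rewrite sqr_enorm; have /matrixP /(_ 0 0) := phi_unit; rewrite !mxE /= => H.
suff -> : fdot phi phi = 1 by [].
by rewrite -[RHS]H; apply: eq_bigr => i _; rewrite big_ord1 !mxE.
Qed.

Let p_le (x : R) : 0 <= x <= 1 - gamma -> `|p.[x]| <= gamma^-1.
Proof.
have g0 := g_gt0; move=> /andP[x0 x1]; have x_lt1 : x < 1 by lra.
apply: (@le_trans _ _ (1 - x)^-1); last by rewrite lef_pV2 ?posrE; lra.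
apply: le_trans (geometric_le m x0 x_lt1); rewrite filter_polyE.
apply: le_trans (ler_norm_sum _ _ _) _; apply: ler_sum => k _.
by rewrite normrM (ger0_norm (exprn_ge0 _ x0)) ler_piMl ?exprn_ge0.
Qed.

Let p'_le (x : R) : 0 <= x <= 1 - gamma -> `|p^`().[x]| <= gamma ^- 2.
Proof.
have g0 := g_gt0; move=> /andP[x0 x1]; have x_lt1 : x < 1 by lra.
apply: (@le_trans _ _ ((1 - x) ^- 2)); last first.
  have y0 : 0 < 1 - x by lra.
  rewrite lef_pV2 ?posrE ?exprn_gt0//.
  by rewrite ler_pXn2r ?nnegrE ?(ltW g0) ?(ltW y0)//; lra.
apply: le_trans (arithgeometric_le m x0 x_lt1).
rewrite /filter_poly raddf_sum horner_sum.
apply: le_trans (ler_norm_sum _ _ _) _; apply: ler_sum => k _ /=.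
rewrite derivZ derivXn hornerZ hornerMn hornerXn normrM.
rewrite -[in leLHS]mulr_natl normrM normr_nat (ger0_norm (exprn_ge0 _ x0)).
by rewrite ler_piMl ?mulr_ge0 ?exprn_ge0.
Qed.

Let F_mono (x y : R) : x <= y -> F.[x] <= F.[y].
Proof.
rewrite le_eqVlt => /predU1P[->//|xy].
have [c _ cE] := poly_mvt F xy.
by rewrite -subr_ge0 cE deriv_F horner_exp mulr_ge0 ?sqr_ge0// subr_ge0 ltW.
Qed.

(** The derivative of [p ^+ 3] is [3 p ^+ 2 p'], where [p ^+ 2] is the derivative of [F] and [p'] is
    at most [gamma ^- 2]. Hence [3 gamma ^- 2 F - e p ^+ 3] is nondecreasing for both signs [e]. *)
Let cube_diff (x y : R) : 0 <= x -> x <= y -> y <= 1 - gamma ->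
  `|p.[y] ^+ 3 - p.[x] ^+ 3| <= 3 * gamma ^- 2 * (F.[y] - F.[x]).
Proof.
have g0 := g_gt0; move=> x0 + y1; rewrite le_eqVlt => /predU1P[->//|xy].
  by rewrite !subrr normr0 mulr0.
have key (e : R) : `|e| = 1 ->
    0 <= 3 * gamma ^- 2 * (F.[y] - F.[x]) - e * (p.[y] ^+ 3 - p.[x] ^+ 3).
  move=> e1; pose q := (3 * gamma ^- 2) *: F - e *: p ^+ 3.
  have -> : 3 * gamma ^- 2 * (F.[y] - F.[x]) - e * (p.[y] ^+ 3 - p.[x] ^+ 3) =
      q.[y] - q.[x].
    by rewrite /q !(hornerD, hornerN, hornerZ, horner_exp); ring.
  have [c cxy ->] := poly_mvt q xy.
  apply: mulr_ge0; last by rewrite subr_ge0 ltW.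
  have -> : q^`().[c] = 3 * p.[c] ^+ 2 * (gamma ^- 2 - e * p^`().[c]).
    rewrite /q derivB !derivZ deriv_F deriv_exp !(hornerD, hornerN, hornerZ,
      hornerMn, hornerM, horner_exp) /=.
    ring.
  apply: mulr_ge0; first by rewrite mulr_ge0 ?sqr_ge0.
  rewrite subr_ge0.
  apply: le_trans (ler_norm _) _; rewrite normrM e1 mul1r p'_le//.
  by move: cxy; rewrite in_itv /= => /andP[? ?]; apply/andP; split; lra.
rewrite ler_norml; have := key 1 (normr1 _); have := key (-1) (normrN1 _).
by rewrite mul1r mulN1r opprK -subr_ge0 => ? ?; apply/andP; split; lra.
Qed.

Lemma hankel_eigenvalue_ge0 : 0 <= sigma.
Proof.
have g0 := g_gt0; have g1 := g_lt; rewrite -F1 -F0 F_mono//; lra.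
Qed.

(* [sigma] is the integral of [p ^+ 2] over the interval [0, 1 - gamma]; since
   [p ^+ 3] varies by at most [3 * sup |p'|] times that integral, [p ^+ 3], and
   hence [p ^+ 4], is controlled by [sigma]. *)
Lemma filter_poly_le (x : R) : 0 <= x <= 1 - gamma ->
  p.[x] ^+ 4 <= (2 / gamma) ^+ 4 * sigma.
Proof.
have g0 := g_gt0; have g1 := g_lt.
move=> x01; have [x0 x1] := andP x01.
have b_gt0 : 0 < 1 - gamma by lra.
(* At this point [p ^+ 2 * (1 - gamma) = sigma], and [1 - gamma > 1 / 3] gives [p ^+ 2 <= 3 * sigma]
   there. The cube is then carried from [c] to [x]. *)
have [c c01] := poly_mvt F b_gt0.
rewrite F1 F0 !subr0 deriv_F horner_exp => sE.
have {}c01 : 0 <= c <= 1 - gamma.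
  by move: c01; rewrite in_itv /= => /andP[? ?]; apply/andP; split; lra.
have [c0 c1] := andP c01.
have s_ge0 := hankel_eigenvalue_ge0.
have sq_c : p.[c] ^+ 2 <= 3 * sigma by rewrite sE; have := sqr_ge0 p.[c]; nra.
have cube : `|p.[x] ^+ 3 - p.[c] ^+ 3| <= 3 * gamma ^- 2 * sigma.
  have k_ge0 : 0 <= 3 * gamma ^- 2 by rewrite mulr_ge0// invr_ge0 sqr_ge0.
  have [xc|cx] := leP x c.
    rewrite distrC; apply: le_trans (cube_diff x0 xc c1) _.
    apply: ler_wpM2l => //; have := F_mono x0; have := F_mono c1.
    by rewrite F0 F1; lra.
  apply: le_trans (cube_diff c0 (ltW cx) x1) _.
  apply: ler_wpM2l => //; have := F_mono c0; have := F_mono x1.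
  by rewrite F0 F1; lra.
set S := gamma^-1; have S1 : 1 <= S by rewrite invf_ge1//; lra.
have pc := p_le c01; have px := p_le x01.
have cube_c : `|p.[c] ^+ 3| <= 3 * sigma * S.
  by rewrite exprSr normrM ler_pM// ger0_norm ?sqr_ge0.
have : `|p.[x] ^+ 3| <= 3 * sigma * S + 3 * gamma ^- 2 * sigma.
  rewrite -[X in `|X|](subrK (p.[c] ^+ 3)) addrC.
  by apply: le_trans (ler_normD _ _) _; apply: lerD.
rewrite -[gamma ^- 2]exprVn -/S => px3.
have -> : p.[x] ^+ 4 = `|p.[x] ^+ 3| * `|p.[x]|.
  by rewrite -normrM -exprSr ger0_norm// (exprM _ 2 2) sqr_ge0.
(* All powers of [S >= 1] are raised to the fourth, and the resulting coefficient 6 is rounded up to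
   16 so that the bound has a clean fourth root. *)
apply: (@le_trans _ _ ((3 * sigma * S + 3 * S ^+ 2 * sigma) * S)).
  by rewrite ler_pM.
rewrite exprMn -/S.
have : sigma * S ^+ 2 <= sigma * S ^+ 4 by rewrite ler_wpM2l// ler_weXn2l.
have : sigma * S ^+ 3 <= sigma * S ^+ 4 by rewrite ler_wpM2l// ler_weXn2l.
have : 0 <= sigma * S ^+ 4 by rewrite mulr_ge0// exprn_ge0//; lra.
have -> : (3 * sigma * S + 3 * S ^+ 2 * sigma) * S = 3 * (sigma * S ^+ 2) + 3 *
  (sigma * S ^+ 3) by ring.
have -> : 2 ^+ 4 * S ^+ 4 * sigma = 16 * (sigma * S ^+ 4) by ring.
lra.
Qed.

End Hankel.

(** * Contraction of the gossip matrix *)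

Section Gossip.
Import spectral complex.
Variable R : realType.
Local Notation C := (complex R).
Local Notation "x %:C" := (real_complex R x) : ring_scope.
Local Notation "M ^t*" := (map_mx Num.conj (trmx M)) (at level 30).

Lemma conjRC (a : R) : Num.conj (a%:C : C) = a%:C.
Proof. by apply/CrealP/complex_realP; exists a. Qed.

Lemma char_poly_conj_mx (F : fieldType) n (U D : 'M[F]_n) : U \in unitmx ->
  char_poly (invmx U *m D *m U) = char_poly D.
Proof.
move=> uU; rewrite /char_poly.
have -> : char_poly_mx (invmx U *m D *m U) =
    map_mx polyC (invmx U) *m char_poly_mx D *m map_mx polyC U.
  rewrite /char_poly_mx mulmxBr mulmxBl -!map_mxM; congr (_ - _).
  by rewrite scalar_mxC -mulmxA -map_mxM mulVmx// map_mx1 mulmx1.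
rewrite !det_mulmx mulrAC -det_mulmx -map_mxM mulVmx// map_mx1 det1.
by rewrite mul1r.
Qed.

(** A real symmetric matrix is diagonalized over the complex numbers as a Hermitian one. The
    diagonal comes in no particular order; unique factorization of the characteristic polynomial
    identifies it with [s] up to permutation. *)
Lemma real_symmetric_spectral n (S : 'M[R]_n) (s : seq R) : S^T = S ->
  char_poly S = \prod_(a <- s) ('X - a%:P) ->
  exists (U : 'M[C]_n) (d : 'I_n -> R),
    [/\ U *m U^t* = 1%:M, U^t* *m U = 1%:M,
        map_mx (real_complex R) S *m U^t* =
          U^t* *m diag_mx (\row_i (d i)%:C)
      & perm_eq [seq d i | i <- enum 'I_n] s].
Proof.
move=> symS charS; pose Sc := map_mx (real_complex R) S.
have hermS : Sc \is hermsymmx.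
  apply: realsym_hermsym.
    by apply/is_hermitianmxP; rewrite expr0 scale1r map_mx_id// map_trmx symS.
  by apply/mxOverP => i j; rewrite mxE; apply/complex_realP; exists (S i j).
have uU := spectral_unitarymx Sc.
have /orthomx_spectralP SE := hermitian_normalmx hermS.
have := hermitian_spectral_diag_real hermS.
move: (spectralmx Sc) (spectral_diag Sc) uU SE => U D uU SE /mxOverP realD.
have unU := unitarymx_unit uU.
have [d dE] : exists d : 'I_n -> R, D = \row_i (d i)%:C.
  exists (fun i => complex.Re (D 0 i)).
  by apply/rowP => i; rewrite mxE RRe_real.
exists U, d; split; first exact/unitarymxP.
- by rewrite -invmx_unitary// mulVmx.
- by rewrite -invmx_unitary// -/Sc SE -dE mulmxK.
apply: (perm_map_inj (@complexI R)); apply: prod_XsubC_eq.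
transitivity (char_poly Sc).
  rewrite SE char_poly_conj_mx// char_poly_trig ?diag_mx_is_trig//.
  rewrite -map_comp big_map big_enum /=; apply: eq_bigr => i _.
  by rewrite dE !mxE eqxx mulr1n.
rewrite -map_char_poly charS rmorph_prod /= big_map; apply: eq_bigr => a _.
by rewrite rmorphB /= map_polyX map_polyC.
Qed.

Lemma stochastic_quad n (S : 'M[R]_n) (v : 'I_n -> R) : S^T = S ->
  (forall i, \sum_j S i j = 1) ->
  \sum_i \sum_j S i j * (v i - v j) ^+ 2 =
    2 * (\sum_i v i ^+ 2 - \sum_i \sum_j S i j * v i * v j).
Proof.
move=> symS rowS.
have H1 : \sum_i \sum_j S i j * v i ^+ 2 = \sum_i v i ^+ 2.
  by apply: eq_bigr => i _; rewrite -mulr_suml rowS mul1r.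
have H2 : \sum_i \sum_j S i j * v j ^+ 2 = \sum_i v i ^+ 2.
  rewrite exchange_big -H1; apply: eq_bigr => i _; apply: eq_bigr => j _.
  by rewrite -[in LHS]symS mxE.
rewrite mulrBr mulr_natl mulr2n -{1}H1 -H2 -big_split /= mulr_sumr -sumrB.
apply: eq_bigr => i _; rewrite -big_split /= mulr_sumr -sumrB.
by apply: eq_bigr => j _; ring.
Qed.

(** The right-hand side is the Dirichlet energy of [v]. Its sign gives [a <= 1], and [a = 1] forces
    it to vanish. *)
Lemma stochastic_eigenvector_quad n (S : 'M[R]_n) (v : 'rV[R]_n) (a : R) :
  S^T = S -> (forall i j, 0 <= S i j) -> (forall i, \sum_j S i j = 1) ->
  v *m S = a *: v ->
  2 * (1 - a) * (\sum_i v 0 i ^+ 2) =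
    \sum_i \sum_j S i j * (v 0 i - v 0 j) ^+ 2.
Proof.
move=> symS S0 rowS vS; rewrite (stochastic_quad (fun i => v 0 i))//.
have -> : \sum_i \sum_j S i j * v 0 i * v 0 j = a * \sum_i v 0 i ^+ 2.
  rewrite exchange_big mulr_sumr; apply: eq_bigr => j _.
  rewrite -mulr_suml expr2 mulrA; congr (_ * _).
  have /rowP /(_ j) := vS; rewrite !mxE => <-.
  by apply: eq_bigr => i _; rewrite mulrC.
by ring.
Qed.

Lemma gossip_sqr_stochastic n (P : 'M[R]_n) (S := P^T *m P) : gossip_matrix P ->
  [/\ S^T = S, forall i j, 0 <= S i j & forall i, \sum_j S i j = 1].
Proof.
case=> _ P0 P_row P_col _ _; split=> [|i j|i]; first by rewrite trmx_mul trmxK.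
  by rewrite mxE; apply: sumr_ge0 => k _; rewrite mxE mulr_ge0.
under eq_bigr do rewrite mxE.
rewrite exchange_big /= -[RHS](P_col i); apply: eq_bigr => k _.
by rewrite -mulr_sumr P_row mulr1 mxE.
Qed.

(* [P^T P] has positive entries along the edges, so a fixed vector, having zero
   Dirichlet energy, is constant on the connected graph. *)
Lemma gossip_sqr_fixed n (P : 'M[R]_n) (v : 'rV[R]_n) : gossip_matrix P ->
  v *m (P^T *m P) = v -> forall i j, v 0 i = v 0 j.
Proof.
move=> gP vS; have [_ P0 _ _ diagP conP] := gP.
set S := P^T *m P in vS.
have [symS S0 rowS] := gossip_sqr_stochastic gP.
rewrite -/S in symS S0 rowS.
have := @stochastic_eigenvector_quad _ S v 1 symS S0 rowS.
rewrite scale1r subrr mulr0 mul0r => /(_ vS)/esym/eqP.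
have ge i j : 0 <= S i j * (v 0 i - v 0 j) ^+ 2 by rewrite mulr_ge0 ?sqr_ge0.
rewrite psumr_eq0 => [/allP /= H|i _]; last by apply: sumr_ge0.
have {}H i j : S i j * (v 0 i - v 0 j) ^+ 2 = 0.
  have := H i (mem_index_enum i); rewrite psumr_eq0// => /allP /= Hi.
  by have /eqP := Hi j (mem_index_enum j).
have edge i j : 0 < P i j -> v 0 i = v 0 j.
  move=> Pij; have /eqP := H i j; rewrite mulf_eq0 sqrf_eq0 subr_eq0.
  suff : 0 < S i j by move=> /gt_eqF -> /= /eqP.
  (* The term [P i i * P i j] alone is positive, thanks to the positive diagonal. *)
  rewrite mxE (bigD1 i)//= mxE ltr_wpDr ?mulr_gt0//.
  by apply: sumr_ge0 => k _; rewrite mxE mulr_ge0.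
move=> i j; have /connectP [p] := conP i j.
elim: p i => [i _ ->//|k p IH i /= /andP[/edge -> pk] jE].
exact: IH.
Qed.

(** In an orthonormal eigenbasis of [P^T P], a vector of zero sum has no component along the
    eigenvalue 1, whose eigenvectors are constant; all other eigenvalues are at most [beta ^+ 2].
    Strictness [beta < 1] is the simplicity of the eigenvalue 1. *)
Lemma gossip_contraction n (P : 'M[R]_n) (beta : R) :
  gossip_matrix P -> second_singular_value P beta ->
  [/\ 0 <= beta, beta < 1 &
    forall v : 'cV[R]_n, \sum_i v i 0 = 0 ->
      enorm (P^T *m v) <= beta * enorm v].
Proof.
move=> gP [s [sorted_s s_ge0 charS] betaE].
have [symP P0 P_row P_col _ _] := gP.
set S := P^T *m P in charS.
have [symS S0 rowS] := gossip_sqr_stochastic gP.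
rewrite -/S in symS S0 rowS.
have sq_eigen a : a \in s -> a ^+ 2 <= 1.
  move=> sa; have : eigenvalue S (a ^+ 2).
    rewrite eigenvalue_root_char charS -(big_map (fun a => a ^+ 2) xpredT (fun b =>
      'X - b%:P)) root_prod_XsubC.
    by apply/mapP; exists a.
  move=> /eigenvalueP [v vS v0].
  have := stochastic_eigenvector_quad symS S0 rowS vS.
  rewrite leNgt => H; apply/negP => a1.
  have v_gt0 : 0 < \sum_i v 0 i ^+ 2.
    rewrite lt_def sumr_ge0 ?andbT => [|i _]; last by rewrite sqr_ge0.
    apply: contra v0; rewrite psumr_eq0 => [/allP /= v0|i _]; last by rewrite sqr_ge0.
    apply/eqP; apply/matrixP => r i; rewrite ord1 mxE; apply/eqP.
    by rewrite -sqrf_eq0 v0 ?mem_index_enum.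
  have : 0 <= 2 * (1 - a ^+ 2) * \sum_i v 0 i ^+ 2.
    by rewrite H; do 2![apply: sumr_ge0 => ? _]; rewrite mulr_ge0 ?sqr_ge0.
  by rewrite pmulr_lge0// pmulr_rge0// subr_ge0 leNgt a1.
have [|U [d [UU UU' SU pd]]] := @real_symmetric_spectral _ S [seq a ^+ 2 | a <- s] symS.
  by rewrite big_map.
have s_ge k : 0 <= nth 0 s k.
  have [ks|ks] := ltnP k (size s); last by rewrite nth_default.
  by move/allP : s_ge0; apply; rewrite mem_nth.
have s_le k : nth 0 s k <= 1.
  have [ks|ks] := ltnP k (size s); last by rewrite nth_default// ler01.
  by rewrite -(@expr_le1 _ 2)// sq_eigen// mem_nth.
have beta_ge0 : 0 <= beta by rewrite betaE.
(* The eigenvector is complex, but the matrix is real, so its real and imaginary parts are fixed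
   separately and the real statement [gossip_sqr_fixed] applies to each. *)
have eigenrow i : d i = 1 -> exists2 c : C, c != 0 & forall k, (U^t*) k i = c.
  move=> di; pose x := col i (U^t*).
  have Sx : map_mx (real_complex R) S *m x = x.
    rewrite /x colE mulmxA SU -!colE mul_mx_diag.
    by apply/matrixP => k l; rewrite !mxE di mulr1.
  have S_part (g : {additive C -> R}) : (forall (a : R) z, g (a%:C * z) = a * g z) ->
      forall k l, g (x k 0) = g (x l 0).
    move=> gZ; suff /(gossip_sqr_fixed gP) fixed : (map_mx g x)^T *m S = (map_mx g x)^T.
      by move=> k l; have := fixed k l; rewrite !mxE.
    apply: trmx_inj; rewrite trmx_mul trmxK symS -[in RHS]Sx.
    apply/colP => k; rewrite !mxE raddf_sum; apply: eq_bigr => l _.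
    by rewrite !mxE gZ.
  have xE k l : x k 0 = x l 0.
    rewrite (complexE (x k 0)) (complexE (x l 0)).
    congr (_%:C + _ * _%:C).
      by apply: (S_part (@complex.Re R : {additive C -> R})) => a [b c] /=;
        rewrite mul0r subr0.
    by apply: (S_part (@complex.Im R : {additive C -> R})) => a [b c] /=;
      rewrite mul0r addr0.
  exists (x i 0); last by move=> k; rewrite -(xE k) !mxE.
  apply/negP => /eqP x0; have /matrixP /(_ i i) := UU; rewrite !mxE eqxx.
  rewrite big1 => [/esym/eqP|k _]; first by rewrite oner_eq0.
  by have := xE k i; rewrite x0 !mxE => ->; rewrite mulr0.
(* Two nonzero constant columns have inner product [n] times a nonzero number, so they cannot be
   orthogonal. *)
have d_inj i j : d i = 1 -> d j = 1 -> i = j.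
  move=> /eigenrow [c c0 Uc] /eigenrow [c' c'0 Uc']; apply/eqP/negPn/negP => ij.
  have /matrixP /(_ i j) := UU; rewrite !mxE (negPf ij).
  under eq_bigr => k _.
    have -> : U i k = (c)^*.
      by rewrite -(Uc k) !mxE conjCK.
    rewrite Uc'; over.
  rewrite sumr_const card_ord => /eqP; rewrite -mulr_natr !mulf_eq0 conjC_eq0.
  rewrite (negPf c0) (negPf c'0) /= pnatr_eq0 => /eqP n0.
  by move: (i); rewrite n0 => -[].
have mem_d i : exists2 k, (k < size s)%N & d i = nth 0 s k ^+ 2.
  have : d i \in [seq a ^+ 2 | a <- s].
    by rewrite -(perm_mem pd) map_f// mem_enum.
  by move=> /mapP [a /(nthP 0) [k ks <-] ->]; exists k.
have mem_1 : (0 < n)%N -> 1 \in [seq a ^+ 2 | a <- s].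
  move=> n_gt0; rewrite -root_prod_XsubC big_map -charS -eigenvalue_root_char.
  apply/eigenvalueP; exists (const_mx 1).
    rewrite scale1r -{1}symS; apply: trmx_inj; rewrite trmx_mul !trmxK trmx_const.
    by apply/colP => i; rewrite !mxE -[RHS](rowS i); apply: eq_bigr => j _;
      rewrite [X in _ * X]mxE mulr1.
  by apply/eqP => /rowP /(_ (Ordinal n_gt0)) /eqP; rewrite !mxE oner_eq0.
have s_mono k l : (k <= l)%N -> nth 0 s l <= nth 0 s k.
  move=> kl; have [ls|ls] := ltnP l (size s); last by rewrite nth_default.
  apply: (sorted_leq_nth (leT := fun a b => b <= a)) => //.
  - by move=> a b c; move=> /[swap]; exact: le_trans.
  - by rewrite inE (leq_ltn_trans kl).
(* From index 1 on, sortedness bounds the singular value by [beta]. At index 0 the value is the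
   largest; since 1 occurs in the list and bounds it, that value is 1, which is excluded. *)
have d_beta i : d i != 1 -> d i <= beta ^+ 2.
  move=> di1; have [[|k] ks dE] := mem_d i; last first.
    by rewrite dE betaE ler_pXn2r ?nnegrE// s_mono.
  exfalso; move: di1; rewrite dE => /eqP; apply.
  have n_gt0 : (0 < n)%N by exact: leq_ltn_trans (ltn_ord i).
  have /mapP [a /(nthP 0) [l ls <-] sl] := mem_1 n_gt0.
  apply/eqP; rewrite eq_le sq_eigen ?mem_nth//= sl.
  by rewrite ler_pXn2r ?nnegrE// s_mono.
(* If the second singular value were 1, so would be the first, and 1 would be counted twice against
   [d_inj]. *)
have beta_lt1 : beta < 1.
  rewrite lt_neqAle betaE s_le andbT; apply/eqP => s1.
  have s0 : nth 0 s 0 = 1 by apply/eqP; rewrite eq_le s_le/= -s1 s_mono.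
  have size_s : (1 < size s)%N.
    by rewrite ltnNge; apply/negP => H; move/eqP: s1;
      rewrite nth_default// eq_sym oner_eq0.
  have : (1 < count_mem 1%R [seq a ^+ 2 | a <- s])%N.
    case: s size_s s0 s1 {sorted_s s_ge0 charS betaE sq_eigen pd s_ge s_le mem_d
      mem_1 s_mono} => [|a [|b s']]//= _ -> ->.
    by rewrite expr1n eqxx.
  rewrite -(permP pd) count_map.
  have -> : count (preim d (pred1 1)) (enum 'I_n) = #|[set i | d i == 1]%SET|.
    by rewrite cardE enumT /= /enum_mem size_filter -enumT; apply: eq_count => i;
      rewrite !inE.
  move=> /card_gt1P [i [j [+ + /eqP]]]; rewrite !inE => /eqP di /eqP dj; apply.
  exact: d_inj.
split=> // v v_sum0.
rewrite -(@ler_pXn2r _ 2) ?nnegrE ?mulr_ge0 ?enorm_ge0// exprMn.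
(* With [y] the coordinates in the eigenbasis, the two squared norms become sums of [|y i|^2],
   without and with the weights [d i], and are compared term by term. *)
pose vc := map_mx (real_complex R) v; pose y := U *m vc.
have enormC (z : 'cV[R]_n) : (enorm z ^+ 2)%:C = ((map_mx (real_complex R) z)^t* *m
  map_mx (real_complex R) z) 0 0.
  rewrite sqr_enormE rmorph_sum mxE; apply: eq_bigr => i _ /=.
  by rewrite big_ord1 !mxE rmorphXn /= expr2; congr (_ * _); rewrite conjRC.
have vcE : vc = U^t* *m y by rewrite /y mulmxA UU' mul1mx.
have Hnorm : (enorm v ^+ 2)%:C = \sum_i y i 0 * (y i 0)^*.
  rewrite enormC -/vc {2}vcE mulmxA.
  have -> : vc^t* *m U^t* = y^t* by rewrite /y trmx_mul map_mxM.
  by rewrite mxE; apply: eq_bigr => i _; rewrite !mxE mulrC.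
have HPnorm : (enorm (P^T *m v) ^+ 2)%:C = \sum_i (d i)%:C * (y i 0 * (y i 0)^*).
  have -> : enorm (P^T *m v) ^+ 2 = (v^T *m (S *m v)) 0 0.
    rewrite sqr_enorm symP /S symP !mulmxA -[v^T *m P]trmxK trmx_mul trmxK symP
      -mulmxA mxE.
    by apply: eq_bigr => i _; rewrite big_ord1 !mxE.
  have -> : ((v^T *m (S *m v)) 0 0)%:C = (vc^t* *m (map_mx (real_complex R) S *m vc))
    0 0.
    transitivity (map_mx (real_complex R) (v^T *m (S *m v)) 0 0);
      first by rewrite [RHS]mxE.
    rewrite !map_mxM; congr ((_ *m _) 0 0).
    by apply/matrixP => i j; rewrite !mxE /= conjRC.
  rewrite {2}vcE [map_mx _ S *m _]mulmxA SU !mulmxA.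
  have -> : vc^t* *m U^t* = y^t* by rewrite /y trmx_mul map_mxM.
  rewrite -!mulmxA -/y mxE; apply: eq_bigr => i _; rewrite mul_diag_mx !mxE.
  by rewrite mulrCA [X in _ * X]mulrC.
rewrite -lecR HPnorm rmorphM /= Hnorm mulr_sumr; apply: ler_sum => i _.
have [/eigenrow [c c0 Uc]|di] := eqVneq (d i) 1; last first.
  by apply: ler_wpM2r; [exact: mul_conjC_ge0|rewrite lecR d_beta].
suff -> : y i 0 = 0 by rewrite mul0r !mulr0.
rewrite /y mxE.
under eq_bigr => k _.
  have -> : U i k = c^* by rewrite -(Uc k) !mxE conjCK.
  over.
rewrite -mulr_sumr.
have -> : \sum_k vc k 0 = (\sum_k v k 0)%:C by rewrite rmorph_sum;
  apply: eq_bigr => k _; rewrite mxE.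
by rewrite v_sum0 mulr0.
Qed.

(** Columnwise use of the vector case: rows are agents, columns are scalar parameters. *)
Lemma gossip_contraction_mx n q (P : 'M[R]_n) (beta : R) (D : 'M[R]_(n, q)) :
  gossip_matrix P -> second_singular_value P beta ->
  (forall k, \sum_i D i k = 0) -> enorm (P^T *m D) <= beta * enorm D.
Proof.
move=> gP sP D0; have [beta_ge0 _ contr] := gossip_contraction gP sP.
rewrite -(@ler_pXn2r _ 2) ?nnegrE ?mulr_ge0 ?enorm_ge0// exprMn.
rewrite !sqr_enorm_col mulr_sumr; apply: ler_sum => k _.
rewrite -exprMn ler_pXn2r ?nnegrE ?mulr_ge0 ?enorm_ge0// colE -mulmxA -colE contr//.
by under eq_bigr do rewrite mxE.
Qed.

End Gossip.

(** * Projected gradient descent with gossip *)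

Section Projection.
Variables (R : realType) (p q : nat).
Implicit Types (S : set 'M[R]_(p, q)) (X Y Z : 'M[R]_(p, q)).

Definition mx_convex S := forall X Y (a : R), 0 <= a -> a <= 1 ->
  S X -> S Y -> S (a *: X + (1 - a) *: Y).

Lemma mx_convex_sum S n (a : 'I_n -> R) (x : 'I_n -> 'M[R]_(p, q)) :
  mx_convex S -> (forall i, 0 <= a i) -> \sum_i a i = 1 ->
  (forall i, S (x i)) -> S (\sum_i a i *: x i).
Proof.
move=> cS; elim: n a x => [|n IH] a x a0; first by rewrite big_ord0 => /esym/eqP;
  rewrite oner_eq0.
rewrite !big_ord_recl => a1 Sx.
have sum_ge0 : 0 <= \sum_(i < n) a (lift ord0 i) by apply: sumr_ge0.
(* The remaining weights are renormalized by [1 - a ord0]; when this is 0, they all vanish. *)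
have [a01|a01] := eqVneq (a ord0) 1.
  have : \sum_(i < n) a (lift ord0 i) == 0.
    by apply/eqP; move: a1; rewrite a01; lra.
  rewrite psumr_eq0// => /allP /= H; rewrite a01 scale1r big1 ?addr0//.
  by move=> i _; have /eqP -> := H i (mem_index_enum i); rewrite scale0r.
have a_lt1 : 0 < 1 - a ord0.
  by rewrite subr_gt0 lt_neqAle a01; lra.
have -> : \sum_(i < n) a (lift ord0 i) *: x (lift ord0 i) =
    (1 - a ord0) *: \sum_(i < n) ((1 - a ord0)^-1 * a (lift ord0 i)) *: x (lift ord0 i).
  rewrite scaler_sumr; apply: eq_bigr => i _.
  by rewrite scalerA mulVKf// gt_eqF.
apply: cS => //; first by lra.
apply: IH => [i| |i//].
  by rewrite mulr_ge0 ?invr_ge0 ?(ltW a_lt1).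
rewrite -mulr_sumr; apply: (mulfI (lt0r_neq0 a_lt1)).
by rewrite mulVKf ?gt_eqF//; lra.
Qed.

(** If the inner product were positive, a short step from [Y] towards [Z] would stay in [S] and come
    closer to [X]. *)
Lemma projection_obtuse S X Y Z : mx_convex S -> is_projection S X Y -> S Z ->
  fdot (X - Y) (Z - Y) <= 0.
Proof.
move=> cS [SY Ymin] SZ; rewrite leNgt; apply/negP => d_gt0.
set d := fdot (X - Y) (Z - Y) in d_gt0.
set e := enorm (Z - Y) ^+ 2; have e_ge0 : 0 <= e by rewrite sqr_ge0.
(* The step changes the squared distance by [a * (a * e - 2 * d)], negative once [a * e <= d].
   Dividing by [1 + e] avoids a zero denominator, and the minimum keeps the combination convex. *)
pose a := Num.min 1 (d / (1 + e)).
have a_gt0 : 0 < a by rewrite lt_min ltr01 divr_gt0//; lra.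
have a_le1 : a <= 1 by rewrite ge_min lexx.
have ae : a * (1 + e) <= d.
  by rewrite -ler_pdivlMr ?ge_min ?lexx ?orbT//; lra.
have := Ymin _ (cS Z Y a (ltW a_gt0) a_le1 SZ SY).
have -> : X - (a *: Z + (1 - a) *: Y) = (X - Y) - a *: (Z - Y).
  by apply/matrixP => i j; rewrite !mxE; ring.
rewrite -(@ler_pXn2r _ 2) ?nnegrE ?enorm_ge0//.
rewrite [leRHS]sqr_enormB fdotZr enormZ (ger0_norm (ltW a_gt0)) exprMn -/d -/e.
have : a * (2 * d) <= a * (a * e) -> 2 * d <= a * e by rewrite ler_pM2l.
by move=> H1 H2; have : 2 * d <= a * e by [apply: H1; lra]; lra.
Qed.

Lemma projection_le S X Y Z : mx_convex S -> is_projection S X Y -> S Z ->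
  enorm (Y - Z) ^+ 2 <= enorm (X - Z) ^+ 2.
Proof.
move=> cS pY SZ; have obtuse := projection_obtuse cS pY SZ.
have -> : X - Z = (X - Y) - (Z - Y) by rewrite opprB addrA subrK.
by rewrite [leRHS]sqr_enormB (enormB Y Z); have := sqr_ge0 (enorm (X - Y)); lra.
Qed.

End Projection.

(** * Joint parameters of all agents *)

Section Stack.
Variables (R : realType) (p q : nat).

(** One flattened agent per row, so that gossip is left multiplication and zero mean is a condition
    on column sums. *)
Definition stack n (V : 'I_n -> 'M[R]_(p, q)) : 'M[R]_(n, p * q) :=
  \matrix_i mxvec (V i).

Lemma enorm_mxvec (X : 'M[R]_(p, q)) : enorm (mxvec X) = enorm X.
Proof.
rewrite /enorm; congr Num.sqrt; rewrite big_ord1 pair_bigA /=.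
rewrite (reindex _ (curry_mxvec_bij _ _)) /=; apply: eq_bigr => -[i j] _ /=.
by rewrite mxvecE.
Qed.

Lemma sqr_enorm_stack n (V : 'I_n -> 'M[R]_(p, q)) :
  enorm (stack V) ^+ 2 = \sum_i enorm (V i) ^+ 2.
Proof.
rewrite sqr_enorm_row; apply: eq_bigr => i _.
by rewrite rowK enorm_mxvec.
Qed.

Lemma enorm_le_stack n (V : 'I_n -> 'M[R]_(p, q)) i : enorm (V i) <= enorm (stack V).
Proof.
rewrite -(@ler_pXn2r _ 2) ?nnegrE ?enorm_ge0// sqr_enorm_stack (bigD1 i)//=.
by rewrite lerDl; apply: sumr_ge0 => j _; rewrite sqr_ge0.
Qed.

Lemma enorm_stack_le n (V : 'I_n -> 'M[R]_(p, q)) a : 0 <= a ->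
  (forall i, enorm (V i) <= a) -> enorm (stack V) <= Num.sqrt n%:R * a.
Proof.
move=> a0 Va; rewrite -(@ler_pXn2r _ 2) ?nnegrE ?mulr_ge0 ?enorm_ge0 ?sqrtr_ge0//.
rewrite sqr_enorm_stack exprMn sqr_sqrtr ?ler0n//.
have -> : n%:R * a ^+ 2 = \sum_(i < n) a ^+ 2 by rewrite sumr_const card_ord mulr_natl.
by apply: ler_sum => i _; rewrite ler_pXn2r ?nnegrE ?enorm_ge0.
Qed.

Lemma stackD n (V W : 'I_n -> 'M[R]_(p, q)) :
  stack (fun i => V i + W i) = stack V + stack W.
Proof. by apply/row_matrixP => i; rewrite linearD /= !rowK linearD. Qed.

Lemma mul_stack n k (A : 'M[R]_(k, n)) (V : 'I_n -> 'M[R]_(p, q)) :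
  A *m stack V = stack (fun i => \sum_j A i j *: V j).
Proof.
apply/row_matrixP => i; rewrite row_mul rowK linear_sum mulmx_sum_row.
by apply: eq_bigr => j _; rewrite linearZ /= rowK mxE.
Qed.

(** After the triangle inequality, the gap is the weighted variance of the norms. *)
Lemma sqr_enorm_jensen n (a : 'I_n -> R) (V : 'I_n -> 'M[R]_(p, q)) :
  (forall i, 0 <= a i) -> \sum_i a i = 1 ->
  enorm (\sum_i a i *: V i) ^+ 2 <= \sum_i a i * enorm (V i) ^+ 2.
Proof.
move=> a0 a1; set b := \sum_i a i * enorm (V i).
have b0 : 0 <= b by apply: sumr_ge0 => i _; rewrite mulr_ge0 ?enorm_ge0.
apply: (@le_trans _ _ (b ^+ 2)).
  rewrite ler_pXn2r ?nnegrE ?enorm_ge0//; apply: le_trans (enorm_sum _ _ _) _.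
  by apply: ler_sum => i _; rewrite enormZ ger0_norm.
rewrite -subr_ge0.
have -> : \sum_i a i * enorm (V i) ^+ 2 - b ^+ 2 = \sum_i a i * (enorm (V i) - b) ^+ 2.
  transitivity (\sum_i (a i * enorm (V i) ^+ 2 - 2 * b * (a i * enorm (V i)) + b ^+ 2
    * a i)).
    by rewrite big_split sumrB /= -!mulr_sumr a1 -/b; ring.
  by apply: eq_bigr => i _; ring.
by apply: sumr_ge0 => i _; rewrite mulr_ge0 ?sqr_ge0.
Qed.

End Stack.

(** * Consensus and regret of the gossip iteration *)

Section DistributedGradient.
Variables (R : realType) (n p q T : nat) (P : 'M[R]_n) (beta eta Gam : R).
Variables (S : set 'M[R]_(p, q)) (M g : 'I_n -> nat -> 'M[R]_(p, q)).
Hypotheses (gP : gossip_matrix P) (sP : second_singular_value P beta).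
Hypotheses (eta_gt0 : 0 < eta) (Gam_ge0 : 0 <= Gam).
Hypotheses (cS : mx_convex S).
Hypothesis M1 : exists2 Z, S Z & forall i, M i 1%N = Z.
Hypothesis M_step : forall i t, (1 <= t <= T)%N ->
  is_projection S (\sum_j P j i *: M j t - eta *: g i t) (M i t.+1).

Lemma iterate_mem i t : (1 <= t <= T.+1)%N -> S (M i t).
Proof.
case: t => [|[|t]]//; first by case: M1 => Z SZ ->.
by rewrite ltnS => tT; have [] := M_step i (t := t.+1) tT.
Qed.

Hypothesis g_le : forall i t, (1 <= t <= T)%N -> enorm (g i t) <= Gam.

Let mix i t := \sum_j P j i *: M j t.
Let avg t := n%:R^-1 *: \sum_i M i t.
(** The fixed point of [r = beta * r + 2 * sqrt n * eta * Gam], the recursion obeyed by the joint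
    deviation from the mean. *)
Definition consensus_radius : R := 2 * Num.sqrt n%:R * (eta * Gam) / (1 - beta).
Local Notation delta := consensus_radius.

Let beta_lt1 : beta < 1. Proof. by case: (gossip_contraction gP sP). Qed.

Lemma consensus_radius_ge0 : 0 <= delta.
Proof.
rewrite /delta mulr_ge0 ?invr_ge0 ?subr_ge0 ?(ltW beta_lt1)//.
by rewrite !mulr_ge0 ?sqrtr_ge0// ltW.
Qed.

Let mix_mem i t : (1 <= t <= T)%N -> S (mix i t).
Proof.
case/andP=> t1 tT; case: gP => _ P0 _ Pc _ _; apply: mx_convex_sum => // j.
by apply: iterate_mem; rewrite t1 ltnW.
Qed.

(** The mixed point lies in [S] by convexity, so projecting cannot move the iterate away from it
    beyond the gradient step. *)
Let mix_dist i t : (1 <= t <= T)%N -> enorm (M i t.+1 - mix i t) <= eta * Gam.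
Proof.
move=> tT; have := projection_le cS (M_step i tT) (mix_mem i tT).
rewrite -/(mix i t) ler_pXn2r ?nnegrE ?enorm_ge0// => /le_trans; apply.
rewrite addrAC subrr add0r enormN enormZ gtr0_norm//.
by rewrite ler_pM2l// g_le.
Qed.

Lemma enorm_convex_sum (a : 'I_n -> R) (V : 'I_n -> 'M[R]_(p, q)) c :
  (forall i, 0 <= a i) -> \sum_i a i = 1 -> (forall i, enorm (V i) <= c) ->
  enorm (\sum_i a i *: V i) <= c.
Proof.
move=> a0 a1 Vc; apply: le_trans (enorm_sum _ _ _) _.
rewrite -[leRHS]mul1r -a1 mulr_suml; apply: ler_sum => i _.
by rewrite enormZ ger0_norm// ler_wpM2l.
Qed.

Lemma consensus i t : (1 <= t <= T.+1)%N -> enorm (M i t - avg t) <= delta.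
Proof.
have [symP P0 Pr Pc _ _] := gP.
have n_gt0 : (0 < n)%N by exact: leq_ltn_trans (ltn_ord i).
have nV : \sum_(i < n) n%:R^-1 = 1 :> R.
  by rewrite sumr_const card_ord -[LHS]mulr_natr mulVf// pnatr_eq0 -lt0n.
have sum_n (Z : 'M[R]_(p, q)) : n%:R^-1 *: \sum_(i < n) Z = Z.
  by rewrite sumr_const card_ord -[Z *+ n]scaler_nat scalerA mulVf ?scale1r//
    pnatr_eq0 -lt0n.
have sumP (Z : 'M[R]_(p, q)) k : \sum_j P j k *: Z = Z.
  by rewrite -scaler_suml Pc scale1r.
pose D t := stack (fun k => M k t - avg t).
suff H : (1 <= t <= T.+1)%N -> enorm (D t) <= delta.
  by move=> /H; apply: le_trans; exact: (enorm_le_stack (fun k => M k t - avg t)).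
elim: t => [//|[_ _|t IH /andP[_ tT]]].
  suff -> : D 1%N = 0 by rewrite enorm0 consensus_radius_ge0.
  case: M1 => Z _ M1E; rewrite /D /avg.
  under [X in n%:R^-1 *: X]eq_bigr do rewrite M1E.
  by apply/row_matrixP => k; rewrite rowK M1E sum_n subrr linear0 row0.
have tT' : (1 <= t.+1 <= T)%N by [].
pose E k := M k t.+2 - mix k t.+1.
pose EA := n%:R^-1 *: \sum_k E k.
have E_le k : enorm (E k) <= eta * Gam by exact: mix_dist.
have mix_avg : n%:R^-1 *: \sum_k mix k t.+1 = avg t.+1.
  congr (_ *: _); rewrite exchange_big /=; apply: eq_bigr => j _.
  by rewrite -scaler_suml Pr scale1r.
(* Rows of [P] summing to 1 make mixing preserve the average, so the average moves by exactly [EA].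
   Deviations have zero column sums and contract by [beta]; the centred step adds at most
   [2 * eta * Gam] per agent. *)
have -> : D t.+2 = P^T *m D t.+1 + stack (fun k => E k - EA).
  rewrite mul_stack -stackD; congr stack; apply/funext => k.
  have -> : \sum_j P^T k j *: (M j t.+1 - avg t.+1) = mix k t.+1 - avg t.+1.
    rewrite -[X in _ = _ - X](sumP _ k) -sumrB; apply: eq_bigr => j _.
    by rewrite [P^T k j]mxE scalerBr.
  rewrite /EA /E sumrB scalerBr mix_avg -/(avg t.+2).
  move: (M k t.+2) (mix k t.+1) (avg t.+1) (avg t.+2) => X1 X2 X3 X4.
  by apply/matrixP => a b; rewrite !mxE; ring.
apply: le_trans (enormD _ _) _.
have D_sum k : \sum_i D t.+1 i k = 0.
  transitivity ((\sum_i mxvec (M i t.+1 - avg t.+1)) 0 k).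
    by rewrite summxE; apply: eq_bigr => j _; rewrite mxE.
  rewrite -linear_sum sumrB /= sumr_const card_ord -[_ *+ n]scaler_nat.
  by rewrite scalerA mulfV ?pnatr_eq0 -?lt0n// scale1r subrr linear0 mxE.
have h1 := gossip_contraction_mx gP sP D_sum.
have h2 : enorm (stack (fun k => E k - EA)) <= Num.sqrt n%:R * (2 * (eta * Gam)).
  apply: enorm_stack_le => [|k]; first by rewrite !mulr_ge0// ltW.
  apply: le_trans (enormD _ _) _; rewrite enormN mulr_natl mulr2n lerD//.
  rewrite /EA scaler_sumr; apply: enorm_convex_sum => // k'.
have h3 := IH (ltnW tT).
have b1 := beta_lt1; have b0 : 0 <= beta by case: (gossip_contraction gP sP).
have h4 : beta * enorm (D t.+1) <= beta * delta by rewrite ler_wpM2l.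
have : (1 - beta) * delta = Num.sqrt n%:R * (2 * (eta * Gam)).
  by rewrite /delta mulrC divfK; [ring|rewrite subr_eq0 gt_eqF].
lra.
Qed.

Lemma consensus_pair i j t : (1 <= t <= T.+1)%N -> enorm (M i t - M j t) <= 2 * delta.
Proof.
move=> tT; have -> : M i t - M j t = (M i t - avg t) - (M j t - avg t).
  by rewrite opprB addrA subrK.
apply: le_trans (enormD _ _) _; rewrite enormN mulr_natl mulr2n.
by rewrite lerD// consensus.
Qed.

Let mix_near i t : (1 <= t <= T.+1)%N -> enorm (M i t - mix i t) <= 2 * delta.
Proof.
move=> tT; have [symP P0 Pr Pc _ _] := gP.
have -> : M i t - mix i t = \sum_j P j i *: (M i t - M j t).
  rewrite -{1}[M i t]scale1r -(Pc i) scaler_suml -sumrB.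
  by apply: eq_bigr => j _; rewrite scalerBr.
by apply: enorm_convex_sum => // j; exact: consensus_pair.
Qed.

Lemma iterate_move i t : (1 <= t <= T)%N ->
  enorm (M i t.+1 - M i t) <= eta * Gam + 2 * delta.
Proof.
move=> tT; have -> : M i t.+1 - M i t = (M i t.+1 - mix i t) - (M i t - mix i t).
  by rewrite opprB addrA subrK.
apply: le_trans (enormD _ _) _; rewrite enormN lerD ?mix_dist ?mix_near//.
by case/andP: tT => -> tT; rewrite ltnW.
Qed.

(** The potential is the sum over agents of squared distances to [Z]. Projection decreases the
    distance from the gradient step, Jensen and double stochasticity show that mixing does not
    increase the potential, and the sum telescopes. *)
Lemma dogd_regret Z rad : S Z ->
  (forall i, enorm (M i 1%N - Z) <= rad) ->
  \sum_(1 <= t < T.+1) \sum_i fdot (g i t) (M i t - Z) <=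
    n%:R * rad ^+ 2 / (2 * eta)
    + T%:R * n%:R * (eta * Gam ^+ 2 / 2 + 2 * Gam * delta).
Proof.
move=> SZ rad1; have [symP P0 Pr Pc _ _] := gP.
pose V t := \sum_i enorm (M i t - Z) ^+ 2.
have e0 := eta_gt0; have G0 := Gam_ge0; have d0 := consensus_radius_ge0.
have step t : (1 <= t <= T)%N -> \sum_i fdot (g i t) (M i t - Z) <=
    (V t - V t.+1) / (2 * eta) + n%:R * (eta * Gam ^+ 2 / 2 + 2 * Gam * delta).
  move=> tT.
  have agent i : fdot (g i t) (M i t - Z) <=
      (enorm (mix i t - Z) ^+ 2 - enorm (M i t.+1 - Z) ^+ 2) / (2 * eta)
      + (eta * Gam ^+ 2 / 2 + 2 * Gam * delta).
    have h1 := projection_le cS (M_step i tT) SZ.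
    (* The gradient is taken at [M i t] but the step starts at the mixed point; this is the price of
       disagreement. *)
    have h2 : fdot (g i t) (M i t - mix i t) <= Gam * (2 * delta).
      apply: le_trans (cauchy_schwarz _ _) _.
      rewrite ler_pM ?enorm_ge0 ?g_le ?mix_near//.
      by case/andP: tT => -> tT; rewrite ltnW.
    have h3 : enorm (g i t) ^+ 2 <= Gam ^+ 2 by rewrite ler_pXn2r ?nnegrE ?enorm_ge0
      ?g_le.
    have h4 : fdot (g i t) (M i t - Z) = fdot (g i t) (mix i t - Z) + fdot (g i t) (M
      i t - mix i t).
      by rewrite -fdotDr; congr fdot; rewrite [RHS]addrC addrA subrK.
    move: h1; rewrite -/(mix i t) addrAC [X in _ <= X]sqr_enormB fdotZr fdotC enormZ
      (gtr0_norm e0) exprMn => h1.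
    have h5 : fdot (g i t) (mix i t - Z) * (2 * eta) <=
       (enorm (mix i t - Z) ^+ 2 - enorm (M i t.+1 - Z) ^+ 2) + (eta * Gam ^+ 2 / 2)
         * (2 * eta).
      have : eta ^+ 2 * enorm (g i t) ^+ 2 <= eta ^+ 2 * Gam ^+ 2 by rewrite
        ler_wpM2l ?sqr_ge0.
      have -> : eta * Gam ^+ 2 / 2 * (2 * eta) = eta ^+ 2 * Gam ^+ 2 by field.
      lra.
    rewrite h4.
    have : fdot (g i t) (mix i t - Z) <= (enorm (mix i t - Z) ^+ 2 - enorm (M i t.+1
      - Z) ^+ 2) / (2 * eta) + (eta * Gam ^+ 2 / 2).
      rewrite -(@ler_pM2r _ (2 * eta)) ?mulr_gt0// [leRHS]mulrDl divfK ?gt_eqF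
        ?mulr_gt0//.
    lra.
  apply: le_trans (ler_sum _ (fun i _ => agent i)) _.
  rewrite big_split /= -mulr_suml sumrB sumr_const card_ord -[X in _ + X]mulr_natl
    lerD2r.
  rewrite ler_pM2r ?invr_gt0 ?mulr_gt0// lerD2r.
  apply: (@le_trans _ _ (\sum_i \sum_j P j i * enorm (M j t - Z) ^+ 2)).
    apply: ler_sum => i _.
    have -> : mix i t - Z = \sum_j P j i *: (M j t - Z).
      rewrite -{1}[Z]scale1r -(Pc i) scaler_suml -sumrB.
      by apply: eq_bigr => j _; rewrite scalerBr.
    by apply: sqr_enorm_jensen.
  rewrite exchange_big /=; apply: ler_sum => j _.
  by rewrite -mulr_suml Pr mul1r.
apply: (@le_trans _ _ (\sum_(1 <= t < T.+1) ((V t - V t.+1) / (2 * eta) + n%:R * (eta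
  * Gam ^+ 2 / 2 + 2 * Gam * delta)))).
  by rewrite !big_nat; apply: ler_sum => t tT; exact: step.
rewrite big_split /= -mulr_suml sumr_const_nat subn1 /= -[X in _ + X <= _]mulr_natl
  mulrA lerD2r.
rewrite ler_pM2r ?invr_gt0 ?mulr_gt0//.
have -> : \sum_(1 <= t < T.+1) (V t - V t.+1) = V 1%N - V T.+1.
  under eq_bigr do rewrite -opprB.
  by rewrite sumrN telescope_sumr// opprB.
have V_ge0 : 0 <= V T.+1 by apply: sumr_ge0 => i _; rewrite sqr_ge0.
apply: (@le_trans _ _ (V 1%N)); first by rewrite lerBlDr lerDl.
rewrite /V mulr_natl -[X in _ *+ X](card_ord n) -sumr_const; apply: ler_sum => i _.
by rewrite ler_pXn2r ?nnegrE ?enorm_ge0// (le_trans (enorm_ge0 _) (rad1 i)).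
Qed.

End DistributedGradient.

(** * Convex cost functions *)

Section Gradients.
Variable R : realType.

(** For steps in (0, 1], convexity bounds the difference quotient at [a] towards [b] by [f b - f a];
    the bound passes to the right-hand limit. *)
Lemma convex_first_order (V : normedModType R) (f : V -> R) (a b : V) :
  convex_function setT f -> differentiable f a ->
  f a - f b <= 'd f a (a - b).
Proof.
move=> cf df; rewrite -[a - b]opprB linearN lerNr opprB -deriveE//.
have := @diff_derivable _ _ _ f a (b - a) df.
move=> /(@cvg_dnbhs_at_right _ _ _ _ _) dcvg.
apply: (cvgr_to_le dcvg).
near=> h.
have h0 : 0 < h by near: h; exact: nbhs_right_gt.
have h1 : h <= 1 by near: h; apply: nbhs_right_le.
rewrite /= -[_ *: _]/(_ * _) mulrC ler_pdivrMr//.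
have := cf (Itv01 (ltW h0) h1) b a (mem_setT _) (mem_setT _).
have -> : conv (Itv01 (ltW h0) h1) (b : convex_lmodType V) a = h *: (b - a) + a :> V.
  rewrite scalerBr addrAC -addrA -[X in _ + (X - _)]scale1r -scalerBl.
  by [].
rewrite convRE /= /unstable.onem; lra.
Unshelve. all: by end_near.
Qed.

(** Along a line, [z] affine makes the difference quotients of the composite literally those of [f]
    in the direction [L X]. Only the coordinate directions are used; linearity of the differential
    supplies the rest. *)
Lemma gradient_affine (V : normedModType R) (f : V -> R) p q
    (z L : 'M[R]_(p, q) -> V) (M : 'M[R]_(p, q)) :
  linear L -> (forall (a : R) X, z (a *: X + M) = a *: L X + z M) ->
  differentiable f (z M) -> forall X,
  fdot (gradient (fun Y => f (z Y)) M) X = 'd f (z M) (L X).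
Proof.
move=> linL zE df X.
have L0 : L 0 = 0 by rewrite -(subrr (0 : 'M[R]_(p, q))) -scaleN1r addrC linL
  scaleN1r addNr.
pose L' : {linear 'M[R]_(p, q) -> V} := HB.pack L (GRing.isLinear.Build _ _ _ _ L linL).
have grad i j : gradient (fun Y => f (z Y)) M i j = 'd f (z M) (L (delta_mx i j)).
  rewrite mxE -deriveE// /derive.
  set F1 := (X in lim (X @ _)); set F2 := (X in _ = lim (X @ _)).
  suff -> : F1 = F2 by [].
  by apply/funext => a; rewrite /F1 /F2 /= zE.
rewrite /fdot; under eq_bigr do under eq_bigr do rewrite grad.
have LE Y : L Y = L' Y by [].
rewrite [in RHS](matrix_sum_delta X) LE [L' _]linear_sum linear_sum.
apply: eq_bigr => i _; rewrite [L' _]linear_sum linear_sum; apply: eq_bigr => j _.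
by rewrite [L' _]linearZ linearZ /= mulrC.
Qed.

Lemma diff_gradients d1 d2 (f : 'cV[R]_d1 * 'cV[R]_d2 -> R) x u dx du :
  differentiable f (x, u) ->
  'd f (x, u) (dx, du) = fdot (gradx f x u) dx + fdot (gradu f x u) du.
Proof.
move=> df.
rewrite (@gradient_affine _ f _ _ (fun y => (y, u)) (fun y => (y, 0))) //; last 2 first.
- by move=> a v w; congr pair; rewrite /= scaler0 addr0.
- by move=> a X; congr pair; rewrite /= scaler0 add0r.
rewrite (@gradient_affine _ f _ _ (fun v => (x, v)) (fun y => (0, y))) //; last 2 first.
- by move=> a v w; congr pair; rewrite /= scaler0 addr0.
- by move=> a X; congr pair; rewrite /= scaler0 add0r.
rewrite -linearD /=; congr ('d f _ _).
by congr pair; rewrite /= ?addr0 ?add0r.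
Qed.

Lemma diff_le d1 d2 (f : 'cV[R]_d1 * 'cV[R]_d2 -> R) x u dx du (c : R) :
  differentiable f (x, u) ->
  enorm (gradx f x u) <= c -> enorm (gradu f x u) <= c ->
  'd f (x, u) (dx, du) <= c * (enorm dx + enorm du).
Proof.
move=> df cx cu; rewrite diff_gradients// mulrDr.
apply: lerD; apply: le_trans (cauchy_schwarz _ _) _;
  exact: ler_wpM2r (enorm_ge0 _) _ _ _.
Qed.

(** By convexity the gradient at the first point alone bounds this one-sided difference, wherever
    the second point lies. *)
Lemma convex_lipschitz d1 d2 (f : 'cV[R]_d1 * 'cV[R]_d2 -> R) x u x' u' (c : R) :
  convex_function setT f -> differentiable f (x, u) ->
  enorm (gradx f x u) <= c -> enorm (gradu f x u) <= c ->
  f (x, u) - f (x', u') <= c * (enorm (x - x') + enorm (u - u')).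
Proof.
move=> cf df cx cu; apply: le_trans (convex_first_order _ cf df) _.
exact: diff_le.
Qed.

End Gradients.

(** * Spectral controllers *)

Lemma stateS (R : realType) d1 d2 (A : 'M[R]_d1) (B : 'M[R]_(d1, d2)) w u t :
  (0 < t)%N -> state A B w u t.+1 = A *m state A B w u t + B *m u t + w t.
Proof. by case: t. Qed.

Section SpectralLinear.
Variables (R : realType) (d1 d2 m h : nat) (A : 'M[R]_d1) (B : 'M[R]_(d1, d2)).
Variables (sigma : nat -> R) (phi : nat -> 'cV[R]_m) (w : nat -> 'cV[R]_d1).

Lemma block_linear (a : R) (M N : params R d1 d2 h) j :
  block (a *: M + N) j = a *: block M j + block N j.
Proof. by apply/matrixP => i k; rewrite !mxE. Qed.

Lemma sqr_enorm_blocks (M : params R d1 d2 h) :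
  enorm M ^+ 2 = \sum_j enorm (block M j) ^+ 2.
Proof.
rewrite sqr_enormE exchange_big /=.
under [RHS]eq_bigr do rewrite sqr_enormE exchange_big /=.
rewrite [RHS]sig_big_dep /= [RHS](reindex _ tagnat.sig_bij_on) /=.
apply: eq_bigr => k _; apply: eq_bigr => i _.
by rewrite mxE tagnat.sig2K.
Qed.

Lemma enorm_block_le (M : params R d1 d2 h) j : enorm (block M j) <= enorm M.
Proof.
rewrite -(@ler_pXn2r _ 2) ?nnegrE ?enorm_ge0// sqr_enorm_blocks (bigD1 j)//=.
by rewrite lerDl; apply: sumr_ge0 => i _; rewrite sqr_ge0.
Qed.

Lemma spectral_control_linear (a : R) (M N : params R d1 d2 h) t :
  spectral_control sigma phi w (a *: M + N) t =
  a *: spectral_control sigma phi w M t + spectral_control sigma phi w N t.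
Proof.
rewrite /spectral_control scaler_sumr -big_split; apply: eq_bigr => j _ /=.
by rewrite block_linear !mulmxDl scalerDr -!scalemxAl !scalerA mulrC.
Qed.

Lemma eq_state (u v : nat -> 'cV[R]_d2) (w' : nat -> 'cV[R]_d1) t :
  (forall s, (1 <= s < t)%N -> u s = v s) ->
  (forall s, (1 <= s < t)%N -> w s = w' s) ->
  state A B w u t = state A B w' v t.
Proof.
elim: t => [//|[//|t] IH] uv ww;
  rewrite !(stateS _ _ _ _ (ltn0Sn t)) uv ?ltnSn// ww ?ltnSn//.
congr (_ *m _ + _ + _); apply: IH => s /andP[s1 st].
  by apply: uv; rewrite s1 ltnW.
by apply: ww; rewrite s1 ltnW.
Qed.

End SpectralLinear.

Section StateLinear.
Variables (R : realType) (d1 d2 : nat) (A : 'M[R]_d1) (B : 'M[R]_(d1, d2)).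

(** Superposition, jointly in disturbances and controls. Weights 1 and [a] with one zero disturbance
    give affineness in the parameters; weights of sum 1 give convex combinations. *)
Lemma state_linear (a b : R) (w w' : nat -> 'cV[R]_d1) (u v : nat -> 'cV[R]_d2) t :
  state A B (fun s => a *: w s + b *: w' s) (fun s => a *: u s + b *: v s) t =
  a *: state A B w u t + b *: state A B w' v t.
Proof.
elim: t => [|[|t] IH]; rewrite ?scaler0 ?addr0//.
rewrite !(stateS _ _ _ _ (ltn0Sn t)) IH !mulmxDr -!scalemxAr !scalerDr.
by rewrite [RHS]addrACA [X in _ = X + _]addrACA.
Qed.

End StateLinear.

Section SpectralState.
Variables (R : realType) (d1 d2 m h : nat) (A : 'M[R]_d1) (B : 'M[R]_(d1, d2)).
Variables (sigma : nat -> R) (phi : nat -> 'cV[R]_m) (w : nat -> 'cV[R]_d1).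
Implicit Types M N : params R d1 d2 h.

Lemma spectral_control_linear2 (a b : R) M N t :
  spectral_control sigma phi w (a *: M + b *: N) t =
  a *: spectral_control sigma phi w M t + b *: spectral_control sigma phi w N t.
Proof.
rewrite spectral_control_linear; congr (_ + _).
have Z0 : spectral_control sigma phi w (0 : params R d1 d2 h) t = 0.
  apply: (addrI (spectral_control sigma phi w (0 : params R d1 d2 h) t)).
  by rewrite -{1}[spectral_control _ _ _ 0 t]scale1r -spectral_control_linear scaler0
    !addr0.
by rewrite -[b *: N]addr0 spectral_control_linear Z0 addr0.
Qed.

(** The linear part of the affine map from parameters to states: the disturbance is removed from the
    dynamics, but the controls still read it. *)
Definition state_response M : nat -> 'cV[R]_d1 :=
  state A B (fun=> 0) (spectral_control sigma phi w M).

Lemma spectral_state_affine (a : R) M N t :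
  spectral_state A B sigma phi w (a *: M + N) t =
  a *: state_response M t + spectral_state A B sigma phi w N t.
Proof.
rewrite -[spectral_state _ _ _ _ _ N t]scale1r /state_response /spectral_state
  -state_linear; apply: eq_state => s _.
  by rewrite spectral_control_linear scale1r.
by rewrite scaler0 add0r scale1r.
Qed.

Lemma state_response_linear t : linear (state_response^~ t).
Proof.
move=> a M N; rewrite -[state_response N t]scale1r -state_linear.
apply: eq_state => s _; first by rewrite spectral_control_linear scale1r.
by rewrite !scaler0 addr0.
Qed.

Lemma spectral_state_convex (a : R) M N t :
  spectral_state A B sigma phi w (a *: M + (1 - a) *: N) t =
  a *: spectral_state A B sigma phi w M t
  + (1 - a) *: spectral_state A B sigma phi w N t.
Proof.
rewrite /spectral_state -state_linear; apply: eq_state => s _.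
  by rewrite spectral_control_linear2.
by rewrite -scalerDl addrC subrK scale1r.
Qed.

Lemma constraint_set_convex (kappa W gamma : R) T :
  mx_convex (@constraint_set R d1 d2 m h kappa W gamma T A B sigma phi w).
Proof.
move=> M N a a0 a1 [xM sM] [xN sN]; split; last first.
  by apply: spectral_norm_convex => //; lra.
move=> t tT; have [xMt uMt] := xM t tT; have [xNt uNt] := xN t tT.
rewrite spectral_state_convex spectral_control_linear2.
by split; apply: enorm_convex => //; lra.
Qed.

Lemma memoryless_gradient (f : 'cV[R]_d1 * 'cV[R]_d2 -> R) t M :
  differentiable f (spectral_state A B sigma phi w M t, spectral_control sigma phi w
    M t) ->
  forall X, fdot (gradient (memoryless_cost A B sigma phi f t w) M) X =
    'd f (spectral_state A B sigma phi w M t, spectral_control sigma phi w M t)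
      (state_response X t, spectral_control sigma phi w X t).
Proof.
move=> df X.
apply: (@gradient_affine _ _ f _ _
  (fun M => (spectral_state A B sigma phi w M t, spectral_control sigma phi w M t))
  (fun X => (state_response X t, spectral_control sigma phi w X t))) => //.
- move=> a Y Z; congr pair; first exact: state_response_linear.
  exact: spectral_control_linear.
- move=> a Y; congr pair; first exact: spectral_state_affine.
  exact: spectral_control_linear.
Qed.

End SpectralState.

(** * Crude size bounds for spectral controllers *)

Section ControlBound.
Variables (R : realType) (d1 d2 m h : nat).
Variables (gamma W : R) (sigma : nat -> R) (phi : nat -> 'cV[R]_m) (w : nat ->
  'cV[R]_d1).
Hypotheses (g_gt0 : 0 < gamma) (g_lt : gamma < 2 / 3) (W_ge0 : 0 <= W).
Hypothesis eig : eigensystem (hankel gamma m) sigma phi.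
Hypothesis w_le : forall t, (1 <= t)%N -> enorm (w t) <= W.

Lemma eigenvector_unit j : (j < m)%N -> (phi j)^T *m phi j = 1%:M.
Proof. by case: eig => _ orth _ _ jm; rewrite orth// eqxx. Qed.

Lemma enorm_eigenvector j : (j < m)%N -> enorm (phi j) = 1.
Proof.
move=> jm; apply/eqP; rewrite -(@eqrXn2 _ 2) ?enorm_ge0// expr1n sqr_enorm.
have /matrixP /(_ 0 0) := eigenvector_unit jm; rewrite !mxE eqxx mulr1n => H.
apply/eqP; rewrite -[RHS]H; apply: eq_bigr => i _.
by rewrite big_ord1 !mxE.
Qed.

Lemma eigenvalue_ge0 j : (j < m)%N -> 0 <= sigma j.
Proof.
case: eig => ev _ _ _ jm.
exact: hankel_eigenvalue_ge0 g_gt0 g_lt (ev _ jm) (eigenvector_unit jm).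
Qed.

(** The entries of the Hankel matrix lie in [0, 1], so its Frobenius norm is at most [m], which is
    polylogarithmic in the end. *)
Lemma eigenvalue_le j : (j < m)%N -> sigma j <= m%:R.
Proof.
move=> jm; have g0 := g_gt0; have g1 := g_lt; case: eig => ev _ _ _.
have -> : sigma j = enorm (hankel gamma m *m phi j).
  by rewrite ev// enormZ enorm_eigenvector// mulr1 ger0_norm// eigenvalue_ge0.
apply: le_trans (enormM _ _) _; rewrite enorm_eigenvector// mulr1.
have -> : m%:R = Num.sqrt (m * m)%:R * 1 :> R.
  by rewrite mulr1 natrM -expr2 sqrtr_sqr ger0_norm.
apply: enorm_le_entries => // i k; rewrite mxE ger0_norm; last first.
  by rewrite mulr_ge0 ?invr_ge0// exprn_ge0//; lra.
rewrite ler_pdivrMr ?ltr0n ?addn1// mul1r.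
apply: (@le_trans _ _ 1); last by rewrite ler1n.
by rewrite exprn_ile1//; lra.
Qed.

Lemma root4_eigenvalue_le j : (j < m)%N -> sigma j `^ (1 / 4) <= m%:R.
Proof.
move=> jm; have m1 : 1 <= m%:R :> R by rewrite ler1n (leq_ltn_trans _ jm).
apply: (@le_trans _ _ (m%:R `^ (1 / 4))).
  by rewrite ge0_ler_powR ?nnegrE ?eigenvalue_ge0 ?eigenvalue_le//; lra.
by rewrite -[leRHS]powRr1// ler_powR//; lra.
Qed.

Lemma enorm_window t : enorm (window m w t) <= m%:R * W.
Proof.
rewrite -(@ler_pXn2r _ 2) ?nnegrE ?mulr_ge0 ?enorm_ge0// sqr_enorm_col.
apply: (@le_trans _ _ (\sum_(k < m) W ^+ 2)).
  apply: ler_sum => k _; rewrite ler_pXn2r ?nnegrE ?enorm_ge0//.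
  have [kt|kt] := boolP (k.+1 < t)%N.
    have -> : col k (window m w t) = w (t - k.+1)%N.
      by apply/colP => i; rewrite !mxE kt.
    by apply: w_le; rewrite subn_gt0.
  have -> : col k (window m w t) = 0 by apply/colP => i; rewrite !mxE (negPf kt).
  by rewrite enorm0.
rewrite sumr_const card_ord -[X in X <= _]mulr_natl exprMn.
rewrite ler_wpM2r ?sqr_ge0// -natrX ler_nat.
by case: (m) => // n; rewrite expnS leq_pmulr// expn_gt0.
Qed.

Lemma enorm_spectral_control (M : params R d1 d2 h) t :
  enorm (spectral_control sigma phi w M t) <= h%:R * m%:R ^+ 2 * W * enorm M.
Proof.
apply: le_trans (enorm_sum _ _ _) _.
have -> : h%:R * m%:R ^+ 2 * W * enorm M = \sum_(j < h) m%:R ^+ 2 * W * enorm M.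
  have -> (c : R) : \sum_(j < h) c = h%:R * c by rewrite sumr_const card_ord mulr_natl.
  by rewrite !mulrA.
apply: ler_sum => j _; have [jm|jm] := ltnP j m; last first.
  (* Padding: beyond [m] the eigenvalue is 0, and so is its power 1/4, the exponent being
     nonzero. *)
  case: eig => _ _ _ -> //; rewrite powR0 ?div1r ?invr_eq0 ?pnatr_eq0// scale0r enorm0.
  by rewrite !mulr_ge0 ?enorm_ge0 ?sqr_ge0.
rewrite enormZ ger0_norm ?powR_ge0// expr2 -!mulrA.
apply: ler_pM; rewrite ?powR_ge0 ?enorm_ge0 ?root4_eigenvalue_le//.
apply: le_trans (enormM _ _) _; rewrite mulrA enorm_eigenvector// mulr1.
apply: le_trans (enormM _ _) _; rewrite mulrC.
by apply: ler_pM; rewrite ?enorm_ge0 ?enorm_window ?enorm_block_le.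
Qed.

Lemma enorm_state_response (A : 'M[R]_d1) (B : 'M[R]_(d1, d2)) (kappa kappaB : R)
    (M : params R d1 d2 h) t :
  diag_stable A B kappa gamma 0 -> spectral_norm B <= kappaB ->
  enorm (state_response A B sigma phi w M t) <=
    kappa ^+ 2 * (kappaB * (h%:R * m%:R ^+ 2 * W * enorm M)) / gamma.
Proof.
move=> stab Bk; have kB := le_trans (spectral_norm_ge0 _) Bk.
have g0 := ltW g_gt0.
have ge0 : 0 <= h%:R * m%:R ^+ 2 * W * enorm M by rewrite !mulr_ge0 ?enorm_ge0 ?sqr_ge0.
case: t => [|t].
  by rewrite /state_response /= enorm0 divr_ge0// mulr_ge0 ?sqr_ge0// mulr_ge0.
apply: (stable_bounded (t := t.+1) (e := fun s => B *m spectral_control sigma phi w M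
  s) g_gt0 stab) => //.
- move=> s /andP[s1 _]; rewrite /state_response stateS// addr0.
  by rewrite mulmx0 addr0.
- move=> s _; apply: le_trans (spectral_norm_mul _ _) _.
  by rewrite ler_pM ?spectral_norm_ge0 ?enorm_ge0 ?enorm_spectral_control.
- by rewrite mulr_ge0.
Qed.

End ControlBound.

(** * Approximation of a stable policy *)

Section Comparator.
Variables (R : realType) (d1 d2 m h : nat) (A : 'M[R]_d1) (B : 'M[R]_(d1, d2)).
Variables (kappa kappaB gamma W : R).
Variables (sigma : nat -> R) (phi : nat -> 'cV[R]_m) (w : nat -> 'cV[R]_d1).
Hypotheses (g_gt0 : 0 < gamma) (g_lt : gamma < 2 / 3) (W_ge0 : 0 <= W).
Hypothesis eig : eigensystem (hankel gamma m) sigma phi.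
Hypothesis w_le : forall t, (1 <= t)%N -> enorm (w t) <= W.
Variables (K : 'M[R]_(d2, d1)) (L Q : 'M[R]_d1).
Hypotheses (uQ : Q \in unitmx) (FE : A + B *m K = Q *m L *m invmx Q).
Hypotheses (Ldiag : is_diag_mx L) (L_ge0 : forall i, 0 <= L i i).
Hypotheses (L_le : spectral_norm L <= 1 - gamma) (K_le : spectral_norm K <= kappa).
Hypotheses (Q_le : spectral_norm Q <= kappa) (Qi_le : spectral_norm (invmx Q) <= kappa).

Local Notation xK := (policy_state A B w K).

Lemma spectral_mul_le p q (X : 'M[R]_(p, q)) (v : 'cV[R]_q) c a :
  spectral_norm X <= c -> enorm v <= a -> enorm (X *m v) <= c * a.
Proof.
move=> Xc va; apply: le_trans (spectral_norm_mul _ _) _.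
by rewrite ler_pM ?spectral_norm_ge0 ?enorm_ge0.
Qed.

Lemma diag_entry_le i : L i i <= 1 - gamma.
Proof.
apply: le_trans L_le; apply: le_trans (_ : enorm (col i L) <= _).
  apply: le_trans (ler_norm _) _.
  by have := entry_le_enorm (col i L) i 0; rewrite mxE.
rewrite colE; apply: le_trans (spectral_norm_mul _ _) _.
by rewrite enorm_delta_mx mulr1.
Qed.

Lemma diag_entry_itv i : 0 <= L i i <= 1 - gamma.
Proof. by rewrite L_ge0 diag_entry_le. Qed.

(** The square matrix of eigenvectors has orthonormal columns, hence orthonormal rows. *)
Lemma eigenbasis_complete i k : \sum_(j < m) phi j i 0 * phi j k 0 = (i == k)%:R.
Proof.
pose F : 'M[R]_m := \matrix_(i, j) phi j i 0.
have FF : F^T *m F = 1%:M.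
  case: eig => _ orth _ _; apply/matrixP => j l.
  have /matrixP /(_ 0 0) := orth j l (ltn_ord j) (ltn_ord l).
  rewrite !mxE eqxx mulr1n => <-.
  by apply: eq_bigr => r _; rewrite !mxE.
have /matrixP /(_ i k) := mulmx1C FF; rewrite !mxE => <-.
by apply: eq_bigr => j _; rewrite !mxE.
Qed.

(** The expansion of the vector [(1, a, ..., a ^+ (m - 1))] in the eigenbasis; its coefficients are
    the values of the filter polynomials at [a]. *)
Lemma filter_expansion (a : R) k :
  \sum_(j < m) (filter_poly (phi j)).[a] * phi j k 0 = a ^+ k.
Proof.
under eq_bigr do rewrite filter_polyE mulr_suml.
rewrite exchange_big /=.
under eq_bigr => i _.
  under eq_bigr do rewrite mulrAC.
  rewrite -mulr_suml eigenbasis_complete; over.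
rewrite (bigD1 k)//= eqxx mul1r big1 ?addr0// => i ik.
by rewrite (negPf ik) mul0r.
Qed.

Lemma scaled_filter_le j (x : R) : (j < m)%N -> 0 <= x <= 1 - gamma ->
  `|(filter_poly (phi j)).[x]| <= 2 / gamma * sigma j `^ (1 / 4).
Proof.
move=> jm x01; have g0 := g_gt0.
have s0 := eigenvalue_ge0 g_gt0 g_lt eig jm; have [ev _ _ _] := eig.
have H := filter_poly_le g_gt0 g_lt (ev _ jm) (eigenvector_unit eig jm) x01.
rewrite -(@ler_pXn2r _ 4) ?nnegrE ?mulr_ge0 ?powR_ge0 ?invr_ge0 ?(ltW g0)//.
rewrite [leRHS]exprMn -(powR_mulrn 4 (powR_ge0 _ _)) -powRrM divfK ?pnatr_eq0//.
rewrite powRr1// -normrX ger0_norm//.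
by rewrite (exprM _ 2 2) sqr_ge0.
Qed.

(* When [sigma j = 0] the inverse is 0 and the filter polynomial vanishes on
   the spectrum of [L], so nothing is lost. *)
Definition comparator_block (j : nat) : 'M[R]_(d2, d1) :=
  if (j < m)%N then
    (sigma j `^ (1 / 4))^-1 *:
      (K *m (Q *m (diag_mx (\row_l (filter_poly (phi j)).[L l l]) *m invmx Q)))
  else 0.

Definition comparator : params R d1 d2 h :=
  mxrow (fun j : 'I_h => comparator_block j).

Lemma block_comparator j : block comparator j = comparator_block j.
Proof. exact: (mxrowK (fun j : 'I_h => comparator_block j)). Qed.

Lemma enorm_diag_mul (a : 'rV[R]_d1) (v : 'cV[R]_d1) c :
  0 <= c -> (forall i, `|a 0 i| <= c) -> enorm (diag_mx a *m v) <= c * enorm v.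
Proof.
move=> c0 ac; rewrite -(@ler_pXn2r _ 2) ?nnegrE ?mulr_ge0 ?enorm_ge0//.
rewrite [leRHS]exprMn !sqr_enormE mulr_sumr; apply: ler_sum => i _.
rewrite !big_ord1 mul_diag_mx mxE exprMn ler_wpM2r ?sqr_ge0//.
by rewrite -real_normK ?num_real// ler_pXn2r ?nnegrE.
Qed.

(** The factor [sigma^(-1/4)] cancels the fourth root in [scaled_filter_le]; [K], [Q] and its
    inverse give [kappa ^+ 3], and [d1] is the cost of passing to the Frobenius norm, whose square
    adds over blocks. *)
Lemma enorm_comparator_block j :
  enorm (comparator_block j) ^+ 2 <= d1%:R * (kappa ^+ 3 * (2 / gamma)) ^+ 2.
Proof.
have g0 := ltW g_gt0; have k0 := le_trans (spectral_norm_ge0 _) Q_le.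
have c0 : 0 <= kappa ^+ 3 * (2 / gamma) by rewrite mulr_ge0 ?exprn_ge0// divr_ge0.
suff H : spectral_norm (comparator_block j) <= kappa ^+ 3 * (2 / gamma).
  apply: (@le_trans _ _ ((Num.sqrt d1%:R * (kappa ^+ 3 * (2 / gamma))) ^+ 2));
    last first.
    by rewrite exprMn sqr_sqrtr.
  rewrite ler_pXn2r ?nnegrE ?enorm_ge0 ?(mulr_ge0 (sqrtr_ge0 _) c0)//.
  by apply: le_trans (enorm_le_spectral_norm _) _; rewrite ler_wpM2l ?sqrtr_ge0.
apply/spectral_norm_leP => // v; rewrite /comparator_block; case: ifP => jm; last first.
  by rewrite mul0mx enorm0 mulr_ge0 ?enorm_ge0.
rewrite -scalemxAl enormZ ger0_norm ?invr_ge0 ?powR_ge0// -!mulmxA.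
set s := sigma j `^ (1 / 4); have s0 : 0 <= s by exact: powR_ge0.
have k3 : enorm (K *m (Q *m (diag_mx (\row_l (filter_poly (phi j)).[L l l]) *m (invmx
  Q *m v))))
    <= kappa * (kappa * ((2 / gamma * s) * (kappa * enorm v))).
  apply: spectral_mul_le => //; apply: spectral_mul_le => //.
  apply: le_trans (enorm_diag_mul (c := 2 / gamma * s) _ _ _) _.
  - by rewrite mulr_ge0// divr_ge0.
  - by move=> i; rewrite mxE scaled_filter_le// diag_entry_itv.
  - apply: ler_wpM2l; first by rewrite !mulr_ge0 ?invr_ge0.
    exact: spectral_mul_le.
have -> : kappa ^+ 3 * (2 / gamma) * enorm v = kappa * (kappa * (2 / gamma * (kappa *
  enorm v))) by ring.
have [s_eq0|s_neq0] := eqVneq s 0.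
  by rewrite s_eq0 invr0 mul0r !mulr_ge0 ?enorm_ge0 ?invr_ge0.
rewrite ler_pdivrMl ?lt_def ?s_neq0//; apply: le_trans k3 _.
by rewrite le_eqVlt; apply/orP; left; apply/eqP; ring.
Qed.

(* As the filters form a complete orthonormal basis, the coefficients of the
   comparator recombine into the first [m] powers of [L]. *)
Definition truncated_state t : 'cV[R]_d1 :=
  \col_l \sum_(k < m) (invmx Q *m window m w t) l k * L l l ^+ k.

Lemma comparator_control t : (m <= h)%N ->
  spectral_control sigma phi w comparator t = K *m (Q *m truncated_state t).
Proof.
move=> mh; rewrite /spectral_control.
under eq_bigr do rewrite block_comparator.
pose F j := (sigma j `^ (1 / 4)) *: (comparator_block j *m window m w t *m phi j).
rewrite -(big_mkord xpredT F) (@big_cat_nat _ _ _ m)//= addrC big_nat big1 ?add0r;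
  last first.
  move=> j /andP[mj _]; case: eig => _ _ _ s0.
  by rewrite /F s0// powR0 ?div1r ?invr_eq0 ?pnatr_eq0// scale0r.
rewrite big_mkord.
have FE' (j : 'I_m) : F j = K *m (Q *m (diag_mx (\row_l (filter_poly (phi j)).[L l l])
    *m (invmx Q *m window m w t *m phi j))).
  rewrite /F /comparator_block ltn_ord -!scalemxAl scalerA.
  have [s0|s0] := eqVneq (sigma j `^ (1 / 4)) 0;
    last by rewrite mulfV// scale1r !mulmxA.
  suff -> : \row_l (filter_poly (phi j)).[L l l] = 0.
    by rewrite s0 mul0r scale0r linear0 mul0mx !mulmx0.
  apply/rowP => l; rewrite !mxE; apply/eqP; rewrite -normr_le0.
  by apply: le_trans (scaled_filter_le (ltn_ord j) (diag_entry_itv l)) _;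
    rewrite s0 mulr0.
under eq_bigr do rewrite FE'.
rewrite -!mulmx_sumr; congr (_ *m (_ *m _)).
apply/colP => l; rewrite summxE mxE.
set Y := invmx Q *m window m w t.
under eq_bigr => j _.
  rewrite mul_diag_mx !mxE mulr_sumr.
  under eq_bigr do rewrite mulrCA.
  over.
rewrite exchange_big /=; apply: eq_bigr => k _.
by rewrite -mulr_sumr filter_expansion.
Qed.

(** Unrolling the recursion [n] times leaves the remainder [a ^+ n * y (t - n)]. Near the start,
    truncated subtraction stops at 0, where the dummy value [y 0 = 0] keeps the formula valid. *)
Lemma convolution_telescope (y v : nat -> R) (a : R) n t :
  y 0%N = 0 -> y 1%N = 0 -> (forall s, (1 <= s)%N -> y s.+1 = a * y s + v s) ->
  \sum_(k < n) (if (k.+1 < t)%N then v (t - k.+1)%N else 0) * a ^+ k =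
  y t - a ^+ n * y (t - n)%N.
Proof.
move=> y0 y1 yS; elim: n => [|n IH]; first by rewrite big_ord0 mul1r subn0 subrr.
rewrite big_ord_recr /= IH; have [nt|tn] := ltnP n.+1 t.
  have -> : (t - n = (t - n.+1).+1)%N by rewrite subnSK// ltnW.
  by rewrite yS ?subn_gt0// exprS; ring.
have -> : y (t - n)%N = 0.
  have : (t - n <= 1)%N by rewrite leq_subLR addn1.
  by case: (t - n)%N => [|[|?]].
have -> : (t - n.+1 = 0)%N by apply/eqP; rewrite subn_eq0.
by rewrite y0 mul0r !mulr0 addr0.
Qed.

Lemma policy_stateS t : (1 <= t)%N -> xK t.+1 = (A + B *m K) *m xK t + w t.
Proof. by case: t => // t _; rewrite mulmxDl -mulmxA. Qed.

(** In the coordinates given by [invmx Q], the policy state splits into scalar recursions of ratio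
    [L l l], to which the telescoping identity applies. *)
Lemma truncated_stateE t :
  truncated_state t = invmx Q *m xK t
    - diag_mx (\row_l L l l ^+ m) *m (invmx Q *m xK (t - m)%N).
Proof.
apply/colP => l; rewrite mxE [RHS]mxE [X in _ = _ + X]mxE mul_diag_mx [X in _ - X]mxE
  [X in _ - X * _]mxE.
pose y s := (invmx Q *m xK s) l 0.
pose v s := (invmx Q *m w s) l 0.
rewrite -/(y t) -/(y (t - m)%N) -(@convolution_telescope y v).
- apply: eq_bigr => k _; congr (_ * _); rewrite mxE.
  case: ifP => kt; last by apply: big1 => r _; rewrite mxE kt mulr0.
  by rewrite /v mxE; apply: eq_bigr => r _; rewrite mxE kt.
- by rewrite /y mulmx0 mxE.
- by rewrite /y mulmx0 mxE.
- move=> s s1; rewrite /y /v policy_stateS// FE mulmxDr !mulmxA mulVmx// mul1mx mxE;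
  congr (_ + _).
  rewrite -mulmxA mxE (bigD1 l)//= big1 ?addr0// => r rl.
  by rewrite (is_diag_mxP Ldiag) 1?eq_sym// mul0r.
Qed.

Lemma enorm_policy_state t : enorm (xK t) <= kappa ^+ 2 * W / gamma.
Proof.
have g0 := ltW g_gt0; case: t => [|t].
  by rewrite enorm0 divr_ge0// mulr_ge0// sqr_ge0.
apply: (stable_bounded (A := A) (B := B) (K := K) (e := w) g_gt0) => //.
- by exists L, Q.
- by move=> s /andP[s1 _]; rewrite policy_stateS.
- by move=> s /andP[s1 _]; exact: w_le.
Qed.

Let err := kappa ^+ 5 * W / gamma * (1 - gamma) ^+ m.

(** The error is [K Q L^m Q^-1] applied to the policy state [m] steps earlier: three factors [kappa]
    for the matrices and two from the bound on that state. *)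
Lemma comparator_control_err t : (m <= h)%N ->
  enorm (spectral_control sigma phi w comparator t - K *m xK t) <= err.
Proof.
move=> mh; have g0 := ltW g_gt0; have g1 : 0 <= 1 - gamma.
  by have := g_lt; lra.
have k0 := le_trans (spectral_norm_ge0 _) Q_le.
rewrite comparator_control// truncated_stateE mulmxBr mulKVmx// mulmxBr.
rewrite addrC addrA addNr sub0r enormN.
have -> : err = kappa * (kappa * ((1 - gamma) ^+ m * (kappa * (kappa ^+ 2 * W /
  gamma)))).
  by rewrite /err; ring.
apply: spectral_mul_le => //; apply: spectral_mul_le => //.
apply: le_trans (enorm_diag_mul (c := (1 - gamma) ^+ m) _ _ _) _.
- by rewrite exprn_ge0.
- move=> i; rewrite mxE ger0_norm ?exprn_ge0//.
  by rewrite lerXn2r ?nnegrE ?diag_entry_le.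
- by rewrite ler_wpM2l ?exprn_ge0// spectral_mul_le// enorm_policy_state.
Qed.

(** The comparator acts in open loop, so the difference of states evolves under [A] alone, which is
    stable, and is forced by [B] times the control error. *)
Lemma comparator_state_err t : (m <= h)%N -> diag_stable A B kappa gamma 0 ->
  spectral_norm B <= kappaB ->
  enorm (spectral_state A B sigma phi w comparator t - xK t) <=
    kappa ^+ 2 * (kappaB * err) / gamma.
Proof.
move=> mh stab Bk; have g0 := ltW g_gt0.
have k0 := le_trans (spectral_norm_ge0 _) Q_le.
have kB0 := le_trans (spectral_norm_ge0 _) Bk.
have err0 : 0 <= err by exact: le_trans (enorm_ge0 _) (comparator_control_err 0 mh).
case: t => [|t].
  by rewrite subrr enorm0 divr_ge0// mulr_ge0 ?sqr_ge0// mulr_ge0.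
pose e s := B *m (spectral_control sigma phi w comparator s - K *m xK s).
pose y s := spectral_state A B sigma phi w comparator s - xK s.
apply: (stable_bounded (x := y) (e := e) g_gt0 stab) => //.
- by rewrite /y subrr.
- move=> s /andP[s1 _]; rewrite /y /spectral_state stateS// policy_stateS//.
  rewrite mulmx0 addr0 /e !mulmxBr mulmxDl mulmxA.
  move: (A *m state _ _ _ _ _) (A *m xK s) (B *m spectral_control _ _ _ _ _) (B *m K
    *m xK s) (w s).
  by move=> X1 X2 X3 X4 X5; apply/matrixP => i j; rewrite !mxE; ring.
- by move=> s _; rewrite spectral_mul_le// comparator_control_err.
- by rewrite mulr_ge0.
Qed.

(** The policy and the truncation error each take at most one third of the allowed radius; the
    condition on [(1 - gamma) ^+ m] ensures this for the state error. The condition on [h] is what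
    [m] blocks of squared norm [d1 * (2 * kappa ^+ 3 / gamma) ^+ 2] require to fit the spectral
    constraint. *)
Lemma comparator_feasible T : 1 < kappa -> (0 < d1)%N ->
  diag_stable A B kappa gamma 0 -> spectral_norm B <= kappaB ->
  1 <= kappaB ->
  2 * m%:R * d1%:R <= gamma * h%:R ->
  kappa ^+ 4 * kappaB * (1 - gamma) ^+ m <= gamma ->
  constraint_set kappa W gamma T A B sigma phi w comparator.
Proof.
move=> k1 d1_gt0 stab Bk kB1 hh hm.
have g0 := g_gt0; have g1 := g_lt; have W0 := W_ge0.
have d1R : 1 <= d1%:R :> R by rewrite ler1n.
have mh : (m <= h)%N.
  rewrite -(ler_nat R); have : 0 <= m%:R :> R by [].
  have : 0 <= h%:R :> R by [].
  by nra.
have kWg : 0 <= kappa ^+ 3 * W / gamma by rewrite !mulr_ge0 ?exprn_ge0 ?invr_ge0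
  ?(ltW g0)//; lra.
have pm : 0 <= (1 - gamma) ^+ m by rewrite exprn_ge0//; lra.
have x_le : kappa ^+ 2 * W / gamma <= kappa ^+ 3 * W / gamma.
  rewrite ler_pM2r ?invr_gt0// ler_wpM2r// ler_weXn2l//; lra.
have xerr : kappa ^+ 2 * (kappaB * err) / gamma <= kappa ^+ 3 * W / gamma.
  have -> : kappa ^+ 2 * (kappaB * err) / gamma =
     kappa ^+ 3 * W / gamma * (kappa ^+ 4 * kappaB * (1 - gamma) ^+ m / gamma).
    by rewrite /err; field; rewrite gt_eqF.
  by rewrite ler_piMr// ler_pdivrMr// mul1r.
have uerr : err <= kappa ^+ 3 * W / gamma.
  have -> : err = kappa ^+ 3 * W / gamma * (kappa ^+ 2 * (1 - gamma) ^+ m).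
    by rewrite /err; field; rewrite gt_eqF.
  rewrite ler_piMr//; apply: (@le_trans _ _ gamma); last by lra.
  apply: le_trans hm; rewrite ler_wpM2r// (exprD _ 2 2) -mulrA ler_peMr ?sqr_ge0//.
  by rewrite -[leLHS]mulr1 ler_pM// expr_ge1//; lra.
have u_le t : enorm (K *m xK t) <= kappa ^+ 3 * W / gamma.
  have -> : kappa ^+ 3 * W / gamma = kappa * (kappa ^+ 2 * W / gamma) by ring.
  by rewrite spectral_mul_le// enorm_policy_state.
split.
  move=> t _; split.
    have := enormD (spectral_state A B sigma phi w comparator t - xK t) (xK t).
    rewrite subrK; have := enorm_policy_state t; have := x_le.
    by have := comparator_state_err t mh stab Bk; lra.
  have := enormD (spectral_control sigma phi w comparator t - K *m xK t) (K *m xK t).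
  by rewrite subrK; have := u_le t; have := comparator_control_err t mh; lra.
apply: le_trans (spectral_norm_le_enorm _) _.
rewrite -(@ler_pXn2r _ 2) ?nnegrE ?enorm_ge0//; last first.
  by rewrite mulr_ge0 ?sqrtr_ge0 ?exprn_ge0//; lra.
rewrite sqr_enorm_blocks exprMn sqr_sqrtr; last by rewrite divr_ge0 ?mulr_ge0// ltW.
pose F j : R := enorm (comparator_block j) ^+ 2.
under eq_bigr do rewrite block_comparator -/(F _).
rewrite -(big_mkord xpredT F) (@big_cat_nat _ _ _ m)//= addrC big_nat big1 ?add0r;
  last first.
  move=> j /andP[mj _]; rewrite /F /comparator_block ltnNge mj /=.
  by rewrite enorm0 expr0n.
rewrite big_mkord.
apply: (@le_trans _ _ (\sum_(j < m) (d1%:R * (kappa ^+ 3 * (2 / gamma)) ^+ 2))).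
  by apply: ler_sum => j _; exact: enorm_comparator_block.
rewrite sumr_const card_ord -[leLHS]mulr_natl.
have -> : m%:R * (d1%:R * (kappa ^+ 3 * (2 / gamma)) ^+ 2) =
   (kappa ^+ 3) ^+ 2 * (2 * (2 * m%:R * d1%:R) / gamma ^+ 2).
  by field; rewrite gt_eqF.
rewrite ler_wpM2l ?sqr_ge0//.
have -> : 2 * h%:R / gamma = 2 * (gamma * h%:R) / gamma ^+ 2.
  by field; rewrite gt_eqF.
by rewrite ler_pM2r ?invr_gt0 ?exprn_gt0// ler_pM2l.
Qed.

End Comparator.

(** * Regret for a given horizon *)

Lemma eq_window (R : realType) d1 m (w w' : nat -> 'cV[R]_d1) t :
  (forall s, (1 <= s < t)%N -> w s = w' s) -> window m w t = window m w' t.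
Proof.
move=> ww; apply/matrixP => a k; rewrite !mxE; case: ifP => // kt.
by rewrite ww// subn_gt0 kt /= ltn_subrL /= (leq_ltn_trans _ kt).
Qed.

(** Causality: the cost at time [t] reads only earlier disturbances, which the agent has already
    recovered exactly. *)
Lemma eq_memoryless_cost (R : realType) d1 d2 m h (A : 'M[R]_d1) (B : 'M[R]_(d1, d2))
    sigma (phi : nat -> 'cV[R]_m) f t (w w' : nat -> 'cV[R]_d1) :
  (forall s, (1 <= s < t)%N -> w s = w' s) ->
  memoryless_cost (h := h) A B sigma phi f t w =
  memoryless_cost (h := h) A B sigma phi f t w'.
Proof.
move=> ww; apply/funext => M;
  rewrite /memoryless_cost /spectral_control (eq_window m ww).
congr (f (_, _)); apply: eq_state => // s /andP[s1 st].
rewrite /spectral_control (eq_window (w' := w') m)// => r /andP[r1 rs].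
by rewrite ww// r1 (ltn_trans rs).
Qed.

Section Regret.
Variables (R : realType) (n d1 d2 m h T : nat) (G kappa kappaB W gamma eta beta : R).
Variables (P : 'M[R]_n) (A : 'M[R]_d1) (B : 'M[R]_(d1, d2)) (w : nat -> 'cV[R]_d1).
Variable f : 'I_n -> nat -> 'cV[R]_d1 * 'cV[R]_d2 -> R.
Variables (sigma : nat -> R) (phi : nat -> 'cV[R]_m).
Variables (M : 'I_n -> nat -> params R d1 d2 h) (x : 'I_n -> nat -> 'cV[R]_d1)
  (u : 'I_n -> nat -> 'cV[R]_d2) (what : 'I_n -> nat -> 'cV[R]_d1).
Hypotheses (d1_gt0 : (0 < d1)%N) (G_gt0 : 0 < G) (k_gt1 : 1 < kappa)
  (kB_gt1 : 1 < kappaB) (W_gt1 : 1 < W) (g_gt0 : 0 < gamma) (g_lt : gamma < 2 / 3)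
  (eta_gt0 : 0 < eta).
Hypotheses (gP : gossip_matrix P) (sP : second_singular_value P beta).
Hypotheses (B_le : spectral_norm B <= kappaB)
  (w_le : forall t, (1 <= t)%N -> enorm (w t) <= W).
Hypothesis f_ok : forall i t, (1 <= t <= T)%N ->
  [/\ forall z, differentiable (f i t) z,
      convex_function setT (f i t) &
      forall (D : R) x u, enorm x <= D -> enorm u <= D ->
        enorm (gradx (f i t) x u) <= G * D /\
        enorm (gradu (f i t) x u) <= G * D].
Hypothesis stab : diag_stable A B kappa gamma 0.
Hypothesis eig : eigensystem (hankel gamma m) sigma phi.
Local Notation S := (@constraint_set R d1 d2 m h kappa W gamma T A B sigma phi w).
Hypothesis run : dosc_run eta S T A B P sigma phi w f M x u what.
Hypotheses (h_large : 2 * m%:R * d1%:R <= gamma * h%:R)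
  (m_large : kappa ^+ 4 * kappaB * (1 - gamma) ^+ m <= gamma).

Definition radius : R := 3 * kappa ^+ 3 * W / gamma.
Definition lip_u : R := h%:R * m%:R ^+ 2 * W.
Definition lip_x : R := kappa ^+ 2 * (kappaB * lip_u) / gamma.
Definition grad_bound : R := G * radius * (lip_x + lip_u).
Local Notation delta := (consensus_radius n beta eta grad_bound).
Definition move_bound : R := eta * grad_bound + 2 * delta.
(** The second term bounds the true state; adding [radius] makes it dominate the controls as well,
    as the gradient assumption asks for one common bound. *)
Definition agent_radius : R := radius + kappa ^+ 2 * (kappaB * radius + W) / gamma.
Definition trunc_err : R := kappa ^+ 5 * W / gamma * (1 - gamma) ^+ m.

Let W_ge0 : 0 <= W. Proof. by apply: ltW; apply: lt_trans W_gt1. Qed.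
Let kB_ge0 : 0 <= kappaB. Proof. by apply: ltW; apply: lt_trans kB_gt1. Qed.
Let k_ge0 : 0 <= kappa. Proof. by apply: ltW; apply: lt_trans k_gt1. Qed.
Let g_ge0 : 0 <= gamma. Proof. exact: ltW. Qed.

Let radius_ge0 : 0 <= radius.
Proof. by rewrite /radius !mulr_ge0 ?exprn_ge0 ?invr_ge0. Qed.
Let lip_u_ge0 : 0 <= lip_u. Proof. by rewrite /lip_u !mulr_ge0 ?sqr_ge0. Qed.
Let lip_x_ge0 : 0 <= lip_x.
Proof. by rewrite /lip_x divr_ge0// mulr_ge0 ?sqr_ge0// mulr_ge0. Qed.
Let grad_bound_ge0 : 0 <= grad_bound.
Proof. by rewrite /grad_bound mulr_ge0 ?addr_ge0// mulr_ge0// ltW. Qed.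
Let agent_radius_ge : radius <= agent_radius.
Proof.
rewrite /agent_radius lerDl divr_ge0// mulr_ge0 ?sqr_ge0// addr_ge0//.
by rewrite mulr_ge0.
Qed.

Let delta_ge0 : 0 <= delta.
Proof. exact: (consensus_radius_ge0 gP sP eta_gt0 grad_bound_ge0). Qed.

Let move_ge0 : 0 <= move_bound.
Proof.
exact: addr_ge0 (mulr_ge0 (ltW eta_gt0) grad_bound_ge0) (mulr_ge0 (ler0n _ 2)
  delta_ge0).
Qed.

Let recovered i t : (1 <= t <= T)%N -> what i t = w t.
Proof.
move=> tT; rewrite (dosc_recover run)// (dosc_dynamics run)//.
by apply/matrixP => a b; rewrite !mxE; ring.
Qed.

Let control_true i t : (1 <= t <= T)%N ->
  u i t = spectral_control sigma phi w (M i t) t.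
Proof.
move=> tT; rewrite (dosc_control run)// /spectral_control (@eq_window _ _ m (what i)
  w)//.
move=> s /andP[s1 st]; apply: recovered; rewrite s1 /=.
by case/andP: tT => _; apply: leq_trans; exact: ltnW.
Qed.

Let grad i t := gradient (memoryless_cost A B sigma phi (f i t) t w) (M i t).

Let cost_true i t : (1 <= t <= T)%N ->
  memoryless_cost (h := h) A B sigma phi (f i t) t (what i) =
  memoryless_cost A B sigma phi (f i t) t w.
Proof.
move=> tT; apply: eq_memoryless_cost => s /andP[s1 st].
apply: recovered; rewrite s1 /=.
by case/andP: tT => _; apply: leq_trans; exact: ltnW.
Qed.

Let M_step i t : (1 <= t <= T)%N ->
  is_projection S (\sum_j P j i *: M j t - eta *: grad i t) (M i t.+1).
Proof. by move=> tT; have := dosc_update run i tT; rewrite cost_true. Qed.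

Let cS : mx_convex S. Proof. exact: constraint_set_convex. Qed.

Let M_mem i t : (1 <= t <= T.+1)%N -> S (M i t).
Proof. exact: (iterate_mem (dosc_M1 run) M_step). Qed.

Let control_diff (X Y : params R d1 d2 h) t :
  spectral_control sigma phi w X t - spectral_control sigma phi w Y t =
  spectral_control sigma phi w (X - Y) t.
Proof.
have := spectral_control_linear2 sigma phi w 1 (-1) X Y t.
by rewrite !scale1r !scaleN1r => ->.
Qed.

Let state_diff (X Y : params R d1 d2 h) t :
  spectral_state A B sigma phi w X t - spectral_state A B sigma phi w Y t =
  state_response A B sigma phi w (X - Y) t.
Proof.
apply/eqP; rewrite subr_eq -[state_response _ _ _ _ _ _ _]scale1r
  -spectral_state_affine.
by rewrite scale1r subrK.
Qed.

Let control_lip (X Y : params R d1 d2 h) t :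
  enorm (spectral_control sigma phi w X t - spectral_control sigma phi w Y t) <=
  lip_u * enorm (X - Y).
Proof. by rewrite control_diff;
  exact: enorm_spectral_control g_gt0 g_lt W_ge0 eig w_le _ _. Qed.

(** State and control are affine in the parameters, so the first-order inequality of [f i t] pulls
    back to them. *)
Let descent i t Z : (1 <= t <= T)%N ->
  memoryless_cost A B sigma phi (f i t) t w (M i t)
    - memoryless_cost A B sigma phi (f i t) t w Z <= fdot (grad i t) (M i t - Z).
Proof.
move=> tT; have [df cf _] := f_ok i tT.
rewrite /grad memoryless_gradient//; apply: le_trans (convex_first_order _ cf (df _)) _.
by rewrite -state_diff -control_diff.
Qed.

(** Tested against itself, the gradient yields its squared norm as the differential of [f i t] along
    the responses to it, whose sizes are linear in its norm. *)
Let grad_le i t : (1 <= t <= T)%N -> enorm (grad i t) <= grad_bound.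
Proof.
move=> tT; have [df cf fG] := f_ok i tT.
have [| xb ub] := (M_mem i (t := t) _).1 t tT; first by case/andP: tT => -> /= /leqW.
have [gx gu] := fG _ _ _ xb ub.
have H : enorm (grad i t) ^+ 2 <= grad_bound * enorm (grad i t).
  rewrite sqr_enorm {1}/grad memoryless_gradient//.
  apply: le_trans (diff_le _ _ (df _) gx gu) _.
  rewrite -/radius /grad_bound -[leRHS]mulrA; apply: ler_wpM2l.
    by rewrite mulr_ge0// ltW.
  rewrite [leRHS]mulrDl; apply: lerD.
    have := enorm_state_response g_gt0 g_lt W_ge0 eig w_le (grad i t) t stab B_le.
    by rewrite /lip_x /lip_u => /le_trans; apply; rewrite le_eqVlt; apply/orP; left;
      apply/eqP; ring.
  exact: enorm_spectral_control g_gt0 g_lt W_ge0 eig w_le _ _.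
have [g0|g0] := eqVneq (enorm (grad i t)) 0; first by rewrite g0.
by move: H; rewrite expr2 ler_pM2r// lt_def g0 enorm_ge0.
Qed.

(** Agent [j] makes [t - s] moves, and one more unit pays for its disagreement with agent [i] at
    time [t]. The count matches the forcing in [stable_drift]. *)
Let agent_gap i j s t : (1 <= s)%N -> (s <= t)%N -> (t <= T)%N ->
  enorm (M j s - M i t) <= (t.+1 - s)%:R * move_bound.
Proof.
move=> s1 st tT.
have mv_ge0 := move_ge0.
have H k : (s + k <= T)%N -> enorm (M j s - M j (s + k)) <= k%:R * move_bound.
  elim: k => [_|k IH]; first by rewrite addn0 subrr enorm0 mul0r.
  rewrite addnS => skT.
  have -> : M j s - M j (s + k).+1 = (M j s - M j (s + k)) + (M j (s + k) - M j (s +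
    k).+1).
    by rewrite addrA subrK.
  apply: le_trans (enormD _ _) _; rewrite -natr1 mulrDl mul1r; apply: lerD.
    by apply: IH; exact: ltnW.
  rewrite enormB; apply: (iterate_move gP sP eta_gt0 grad_bound_ge0 cS (dosc_M1 run)
    M_step grad_le).
  by rewrite (leq_trans s1 (leq_addr _ _))/= ltnW.
have -> : M j s - M i t = (M j s - M j t) + (M j t - M i t) by rewrite addrA subrK.
apply: le_trans (enormD _ _) _; rewrite subSn// -natr1 mulrDl mul1r; apply: lerD.
  by have := H (t - s)%N; rewrite subnKC//; exact.
apply: (@le_trans _ _ (2 * delta));
  last by rewrite /move_bound lerDr (mulr_ge0 (ltW eta_gt0)).
apply: (consensus_pair gP sP eta_gt0 grad_bound_ge0 cS (dosc_M1 run) M_step grad_le).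
by rewrite (leq_trans s1 st) /= leqW.
Qed.

(** The constraint set bounds states for frozen parameters only. It does bound each control actually
    played, and open-loop stability turns this into a bound on the true state. *)
Let agent_state_le j t : (1 <= t <= T)%N -> enorm (x j t) <= agent_radius.
Proof.
move=> /andP[t1 tT].
apply: (@le_trans _ _ (kappa ^+ 2 * (kappaB * radius + W) / gamma));
  last by rewrite /agent_radius lerDr.
apply: (stable_bounded (x := x j) (e := fun s => B *m u j s + w s) g_gt0 stab) => //.
- exact: (dosc_x1 run).
- move=> s /andP[s1 st]; rewrite (dosc_dynamics run) ?s1 ?(ltnW (leq_trans st tT))//.
  by rewrite mulmx0 addr0 addrA.
- move=> s /andP[s1 st]; have sT : (s <= T)%N by exact: ltnW (leq_trans st tT).
  apply: le_trans (enormD _ _) _; apply: lerD; last exact: w_le.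
  apply: spectral_mul_le => //; rewrite control_true ?s1//.
  have := (M_mem j (t := s) _).1 s; rewrite s1 sT /= leqW// => /(_ isT isT) [_].
  exact.
- by rewrite addr_ge0// mulr_ge0.
Qed.

(** The true trajectory is compared with the one that uses [M i t] from the start: the forcing is
    [B] times a control gap growing linearly into the past. *)
Let agent_state_gap i j t : (1 <= t <= T)%N ->
  enorm (x j t - spectral_state A B sigma phi w (M i t) t) <=
    2 * kappa ^+ 2 * (kappaB * lip_u * move_bound) / gamma ^+ 2.
Proof.
move=> /andP[t1 tT]; have g0 := g_gt0; have g1 := g_lt.
have mv_ge0 := move_ge0.
pose y s := x j s - spectral_state A B sigma phi w (M i t) s.
pose e s := B *m (u j s - spectral_control sigma phi w (M i t) s).
apply: (stable_drift (x := y) (e := e) g_gt0 _ stab) => //.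
- by lra.
- by rewrite /y (dosc_x1 run) subrr.
- move=> s /andP[s1 st]; rewrite /y (dosc_dynamics run) ?s1 ?(ltnW (leq_trans st tT))//.
  rewrite /spectral_state stateS// mulmx0 addr0 /e !mulmxBr.
  move: (A *m x j s) (A *m state _ _ _ _ _) (B *m u j s) (B *m spectral_control _ _ _
    _ _) => X1 X2 X3 X4.
  by apply/matrixP => a b; rewrite !mxE; ring.
- move=> s /andP[s1 st]; have sT : (s <= T)%N by exact: ltnW (leq_trans st tT).
  rewrite /e -2!mulrA; apply: spectral_mul_le => //.
  rewrite control_true ?s1//; apply: le_trans (control_lip _ _ _) _.
  by rewrite ler_wpM2l// mulrC agent_gap// ltnW.
- by rewrite !mulr_ge0.
Qed.

Let agent_control_gap i j t : (1 <= t <= T)%N ->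
  enorm (u j t - spectral_control sigma phi w (M i t) t) <= lip_u * move_bound.
Proof.
move=> tT; rewrite control_true//; apply: le_trans (control_lip _ _ _) _.
case/andP: tT => t1 tT; rewrite ler_wpM2l//.
by have := agent_gap i j t1 (leqnn t) tT; rewrite subSn// subnn mul1r.
Qed.

(** Twice the spectral bound of the constraint set, converted to the Frobenius norm over [h * d1]
    columns. *)
Definition diameter : R := 2 * (Num.sqrt (h * d1)%N%:R * (kappa ^+ 3 * Num.sqrt (2 *
  h%:R / gamma))).

Let diameter_bound (X Y : params R d1 d2 h) : S X -> S Y -> enorm (X - Y) <= diameter.
Proof.
move=> [_ sX] [_ sY]; apply: le_trans (enormD _ _) _;
  rewrite enormN /diameter mulr_natl mulr2n.
have bound (Z : params R d1 d2 h) :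
    spectral_norm Z <= kappa ^+ 3 * Num.sqrt (2 * h%:R / gamma) ->
    enorm Z <= Num.sqrt (h * d1)%N%:R * (kappa ^+ 3 * Num.sqrt (2 * h%:R / gamma)).
  move=> sZ; apply: le_trans (enorm_le_spectral_norm _) _.
  have -> : Num.sqrt (\sum_(j < h) d1)%N%:R = Num.sqrt (h * d1)%N%:R :> R.
    by rewrite sum_nat_const card_ord.
  by rewrite ler_wpM2l ?sqrtr_ge0.
by apply: lerD; exact: bound.
Qed.

(* The parameters of agent [j] up to time [t] differ from those of agent [i] at
   time [t], where the gradient is taken. *)
Definition tracking_loss : R := G * agent_radius *
  (2 * kappa ^+ 2 * (kappaB * lip_u * move_bound) / gamma ^+ 2 + lip_u * move_bound).
Definition truncation_loss : R := G * radius *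
  (kappa ^+ 2 * (kappaB * trunc_err) / gamma + trunc_err).

(** Each [f i t] is followed along a chain: the trajectory of agent [j], the memoryless cost at
    [M i t], that at the comparator, and the policy. The links cost tracking, gradient regret and
    truncation. *)
Lemma dosc_regret j K : diag_stable A B kappa gamma K ->
  agent_cost T f (x j) (u j) - policy_cost T A B w f K <=
    T%:R * n%:R * (tracking_loss + truncation_loss)
    + (n%:R * diameter ^+ 2 / (2 * eta)
       + T%:R * n%:R * (eta * grad_bound ^+ 2 / 2 + 2 * grad_bound * delta)).
Proof.
move=> [L [Q [[uQ FE Ldiag L0] [Lg Kk Qk Qk']]]].
have d_gt0 := d1_gt0; have k1 := k_gt1; have kB1 := ltW kB_gt1.
pose Z := comparator h sigma phi K L Q.
have mh : (m <= h)%N.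
  have hl := h_large; have g0 := g_gt0; have g1 := g_lt.
  have d1R : 1 <= d1%:R :> R by rewrite ler1n.
  rewrite -(ler_nat R); have : 0 <= m%:R :> R by [].
  have : 0 <= h%:R :> R by [].
  by nra.
have SZ : S Z := comparator_feasible g_gt0 g_lt W_ge0 eig w_le uQ FE Ldiag L0 Lg Kk
  Qk Qk' T k1 d_gt0 stab B_le kB1 h_large m_large.
have reg := dogd_regret gP sP eta_gt0 grad_bound_ge0 cS (dosc_M1 run) M_step grad_le SZ.
have := reg diameter (fun i => diameter_bound (M_mem i (t := 1%N) isT) SZ).
set rest := (X in _ <= X) => {}reg; apply: le_trans (lerD (lexx _) reg).
rewrite /policy_cost /agent_cost -sumrB.
have -> : T%:R * n%:R * (tracking_loss + truncation_loss) =
    \sum_(1 <= t < T.+1) \sum_(i < n) (tracking_loss + truncation_loss).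
  by rewrite sumr_const_nat sumr_const card_ord subn1 /= -mulrnA -[RHS]mulr_natl
    natrM [X in _ = X * _]mulrC.
rewrite -big_split !big_nat; apply: ler_sum => t tT /=.
rewrite -sumrB -big_split; apply: ler_sum => i _ /=.
have [df cf fG] := f_ok i tT.
have := descent i Z tT; rewrite /memoryless_cost.
have [xZ uZ] := SZ.1 t tT.
have track : f i t (x j t, u j t) - f i t (spectral_state A B sigma phi w (M i t) t,
  spectral_control sigma phi w (M i t) t) <= tracking_loss.
  have ux : enorm (u j t) <= agent_radius.
    apply: le_trans agent_radius_ge; rewrite control_true//.
    by apply: ((M_mem j (t := t) _).1 t tT).2; case/andP: tT => -> /= /leqW.
  have [gx gu] := fG _ _ _ (agent_state_le j tT) ux.
  apply: le_trans (convex_lipschitz _ _ cf (df _) gx gu) _.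
  rewrite /tracking_loss ler_wpM2l ?lerD ?agent_state_gap ?agent_control_gap//.
  by rewrite mulr_ge0 ?(ltW G_gt0)// (le_trans radius_ge0).
have trunc : f i t (spectral_state A B sigma phi w Z t, spectral_control sigma phi w
  Z t)
   - f i t (policy_state A B w K t, K *m policy_state A B w K t) <= truncation_loss.
  have [gx gu] := fG _ _ _ xZ uZ.
  apply: le_trans (convex_lipschitz _ _ cf (df _) gx gu) _.
  rewrite /truncation_loss /radius; apply: ler_wpM2l.
    by rewrite mulr_ge0 ?(ltW G_gt0)//; exact: radius_ge0.
  apply: lerD.
    exact: (comparator_state_err g_gt0 g_lt W_ge0 eig w_le uQ FE Ldiag L0 Lg Kk Qk Qk').
  exact: (comparator_control_err g_gt0 g_lt W_ge0 eig w_le uQ FE Ldiag L0 Lg Kk Qk Qk').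
lra.
Qed.

End Regret.

(** * Asymptotics of the hyper-parameters and of the bound *)

Ltac positivity := repeat match goal with
  | |- is_true (0 < _ * _) => apply: mulr_gt0
  | |- is_true (0 <= _ * _) => apply: mulr_ge0
  | |- is_true (0 < _%:R) => rewrite ltr0n
  | |- is_true (0 < _ ^+ _) => apply: exprn_gt0
  | |- is_true (0 <= _ ^+ _) => apply: exprn_ge0
  | |- is_true (0 < _ `^ _) => apply: powR_gt0
  | |- is_true (0 < _^-1) => rewrite invr_gt0
  | |- is_true (0 <= _^-1) => rewrite invr_ge0
  end; try done; try exact: ltW.

Lemma absz_ceil_ge (R : realType) (y : R) : 0 < y -> y <= (`|Num.ceil y|%N)%:R.
Proof.
move=> y0; rewrite natr_absz ger0_norm ?ceil_ge// ceil_ge0.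
by apply: lt_trans y0; rewrite ltrN10.
Qed.

Lemma absz_ceil_le (R : realType) (y : R) : 0 < y -> (`|Num.ceil y|%N)%:R <= y + 1.
Proof.
move=> y0; rewrite natr_absz ger0_norm; last first.
  by rewrite ceil_ge0; apply: lt_trans y0; rewrite ltrN10.
by have := ceilB1_lt y; rewrite intrD; lra.
Qed.

Lemma sqrtr_le_self (R : realType) (y : R) : 1 <= y -> Num.sqrt y <= y.
Proof.
move=> y1; have y0 : 0 <= y by lra.
rewrite -[leRHS](ger0_norm y0) -sqrtr_sqr ler_wsqrtr//.
by rewrite expr2 ler_peMl.
Qed.

Lemma ln_le_mono (R : realType) (x y : R) : 0 < x -> x <= y -> ln x <= ln y.
Proof. by move=> x0 xy; rewrite ler_ln ?posrE// (lt_le_trans x0). Qed.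

Lemma ln_sqrt (R : realType) (y : R) : 0 < y -> ln (Num.sqrt y) = ln y / 2.
Proof.
move=> y0; rewrite -[in RHS](sqr_sqrtr (ltW y0)) expr2 lnM ?posrE ?sqrtr_gt0//.
by field.
Qed.

Lemma ln_exp_le (R : realType) (y : R) k : 0 < y -> ln (y ^+ k) <= k%:R * y.
Proof.
move=> y0; rewrite lnXn// -[leLHS]mulr_natl ler_wpM2l//.
by apply: ltW; exact: ln_sublinear.
Qed.

Lemma onem_exp_le (R : realType) (g : R) k : 0 <= g <= 1 -> (1 - g) ^+ k <= expR (-
  (g * k%:R)).
Proof.
move=> /andP[g0 g1]; rewrite -mulNr expRM_natr lerXn2r ?nnegrE ?expR_ge0//;
  first by lra.
by have := expR_ge1Dx (- g); lra.
Qed.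

(** The comparison behind the conditions is that [h] is at least [(ln T) ^+ 2], while [m] is at most
    [2 * ln T / gamma]. *)
Lemma hyperparameters (R : realType) (G kappa kappaB W gamma : R) (d : nat) :
  (0 < d)%N -> 0 < G -> 1 < kappa -> 1 < kappaB -> 1 < W -> 0 < gamma ->
  gamma < 2 / 3 -> exists L0 : R, forall T : nat, L0 <= ln T%:R ->
  let m := dosc_m G kappaB kappa W gamma T in
  let h := dosc_h G kappaB kappa W gamma d T in
  let l := ln T%:R in
  [/\ [/\ 100 <= l, gamma^-1 <= l, G <= l, kappa <= l & kappaB <= l],
      [/\ W <= l, d%:R <= l, (0 < T)%N, (0 < m)%N & (0 < h)%N],
      m%:R <= l ^+ 3, h%:R <= l ^+ 3 &
      [/\ 2 * m%:R * d%:R <= gamma * h%:R,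
          kappa ^+ 4 * kappaB * (1 - gamma) ^+ m <= gamma &
          (1 - gamma) ^+ m <= l / Num.sqrt T%:R]].
Proof.
move=> d_gt0 G0 k1 kB1 W1 g0 g1.
have k0 : 0 < kappa by lra.
have kB0 : 0 < kappaB by lra.
have W0 : 0 < W by lra.
pose c1 := 8 * G * kappaB * kappa ^+ 8 * W ^+ 2 / gamma ^+ 3.
have c1_gt0 : 0 < c1 by rewrite /c1; positivity.
pose q := ln (2 / gamma) `^ (1 / 4).
have q_gt0 : 0 < q.
  rewrite powR_gt0// ln_gt0// ltr_pdivlMr//; lra.
pose c2 := 600 * G * kappaB * kappa ^+ 8 * W ^+ 2 / gamma `^ (5 / 2) * q.
have c2_gt0 : 0 < c2 by rewrite /c2; positivity.
pose c3 := kappa ^+ 4 * kappaB / gamma.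
have c3_gt0 : 0 < c3 by rewrite /c3; positivity.
(* One summand per requirement; as all are nonnegative, [L0 <= ln T] yields each of them
   separately. *)
pose L0 : R := 100 + gamma^-1 + G + kappa + kappaB + W + d%:R + 4 * d%:R / gamma ^+ 2
  + c1^-1 + c2 + c2^-1 + 2 * `|ln c1| + 2 * `|ln c3|.
have mE T : dosc_m G kappaB kappa W gamma T =
    `|Num.ceil (gamma^-1 * ln (c1 * Num.sqrt T%:R))|%N.
  by rewrite /dosc_m; congr (`|Num.ceil (_ * ln _)|%N); rewrite /c1 mulrAC.
have hE T : let m := dosc_m G kappaB kappa W gamma T in
    dosc_h G kappaB kappa W gamma d T =
    `|Num.ceil (2 * ln T%:R * ln (c2 * ln T%:R * Num.sqrt (m * d * T)%N%:R))|%N.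
  rewrite /= /dosc_h; congr (`|Num.ceil (_ * ln _)|%N); rewrite /c2 -/q; ring.
have c3E (k : R) : kappa ^+ 4 * kappaB * k = gamma * (c3 * k).
  by rewrite /c3; field; rewrite lt0r_neq0.
exists L0; rewrite {}/L0; clearbody c1 c2 c3 => T L0l; cbv zeta.
move: (mE T) (hE T) => {mE hE}; cbv zeta.
set m := dosc_m _ _ _ _ _ _; set h := dosc_h _ _ _ _ _ _ _;
  set l := ln T%:R in L0l * => mE hE.
have gi0 : 0 < gamma^-1 by rewrite invr_gt0.
have d0 : 1 <= d%:R :> R by rewrite ler1n.
have e1 : 0 < 4 * d%:R / gamma ^+ 2 by positivity; rewrite ltr0n.
have e2 : 0 < c1^-1 by rewrite invr_gt0.
have e3 : 0 < c2^-1 by rewrite invr_gt0.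
have e4 := normr_ge0 (ln c1); have e5 := normr_ge0 (ln c3).
have [l100 lg lG lk lkB] : [/\ 100 <= l, gamma^-1 <= l, G <= l, kappa <= l & kappaB
  <= l].
  by split; lra.
have [lW ld ldg lc1 lc2] : [/\ W <= l, d%:R <= l, 4 * d%:R / gamma ^+ 2 <= l, c1^-1
  <= l & c2 <= l].
  by split; lra.
have [lc2' lnc1 lnc3] : [/\ c2^-1 <= l, 2 * `|ln c1| + 100 <= l & 2 * `|ln c1| + 2 *
  `|ln c3| <= l].
  by split; lra.
have /andP[n1 n1'] : - `|ln c1| <= ln c1 <= `|ln c1| by rewrite -ler_norml.
have /andP[n3 n3'] : - `|ln c3| <= ln c3 <= `|ln c3| by rewrite -ler_norml.
clear L0l e1 e2 e3 e4 e5.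
(* The logarithm of 0 is 0 by convention, so a large [ln T] excludes [T = 0]. *)
have T_gt0 : (0 < T)%N.
  rewrite lt0n; apply/eqP => T0; move: l100; rewrite /l T0 ln0//; lra.
have TR : 0 < T%:R :> R by rewrite ltr0n.
set rt := Num.sqrt T%:R; have rt0 : 0 < rt by rewrite sqrtr_gt0.
have lnrt : ln rt = l / 2 by rewrite ln_sqrt.
have l1 : 1 <= l by apply: le_trans l100; rewrite ler1n.
have l0 : 0 < l := lt_le_trans ltr01 l1.
(* The real number under the ceiling: [gamma * am = ln (c1 * rt)], so that [(1 - gamma) ^+ m] will
   be at most [expR (- (gamma * m))], hence at most [(c1 * rt)^-1]. *)
pose am := gamma^-1 * (ln c1 + l / 2).
have {}mE : m = `|Num.ceil am|%N by rewrite mE lnM ?posrE// lnrt.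
have am_ge : 1 <= am.
  by rewrite /am -[leLHS](mulVf (lt0r_neq0 g0)) ler_pM2l//; clear -n1 lnc1 l1 g1; lra.
have am_gt0 : 0 < am := lt_le_trans ltr01 am_ge.
have m_ge : am <= m%:R by rewrite mE absz_ceil_ge.
have m_le : m%:R <= 2 * l / gamma.
  rewrite mE; apply: le_trans (absz_ceil_le am_gt0) _.
  have : am <= gamma^-1 * l by rewrite /am ler_pM2l//; clear -n1' lnc1 l1; lra.
  have : 1 <= gamma^-1 * l.
    by rewrite -[leLHS](mulVf (lt0r_neq0 g0)) ler_pM2l//; clear -g1 l1; lra.
  have -> : 2 * l / gamma = gamma^-1 * l + gamma^-1 * l by ring.
  by lra.
have m_gt0 : (0 < m)%N by rewrite -(ltr_nat R); apply: lt_le_trans m_ge.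
have m_cube : m%:R <= l ^+ 3.
  apply: le_trans m_le _; rewrite mulrAC -mulrA exprS.
  have : l * gamma^-1 <= l * l by rewrite ler_pM2l.
  have l2 : 2 <= l by apply: le_trans l100; rewrite ler_nat.
  have : 2 * (l * l) <= l * (l * l) by rewrite ler_wpM2r ?mulr_ge0// ltW.
  by rewrite expr2; clear; lra.
pose a := c2 * l * Num.sqrt (m * d * T)%N%:R.
have {}hE : h = `|Num.ceil (2 * l * ln a)|%N by rewrite hE.
have md1 : (1 <= m * d)%N by rewrite muln_gt0 m_gt0.
have a_ge : rt <= a.
  have cl : 1 <= c2 * l by rewrite -[leLHS](mulfV (lt0r_neq0 c2_gt0)) ler_pM2l.
  rewrite /a -[leLHS]mul1r; apply: ler_pM => //; first exact: ltW.
  by apply: ler_wsqrtr; rewrite ler_nat leq_pmull.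
have a_le : a <= l ^+ 6 * rt.
  rewrite /a natrM sqrtrM// mulrA ler_pM2r//.
  have : Num.sqrt (m * d)%N%:R <= l ^+ 4.
    apply: (@le_trans _ _ (m * d)%N%:R); first by rewrite sqrtr_le_self// ler1n.
    by rewrite natrM exprSr ler_pM.
  move=> H; rewrite (exprD l 2 4) expr2; apply: ler_pM => //.
  - by rewrite mulr_ge0 ?ltW.
  - by rewrite ler_pM2r.

have a_gt0 : 0 < a by exact: lt_le_trans a_ge.
(* With [a] between [rt] and [l ^+ 6 * rt], its logarithm lies between [l / 2] and [7 * l], hence
   [h] between [l ^+ 2] and [14 * l ^+ 2 + 1]. *)
have lna_ge : l / 2 <= ln a by rewrite -lnrt ln_le_mono.
have lna_le : ln a <= 7 * l.
  apply: le_trans (ln_le_mono a_gt0 a_le) _.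
  by rewrite lnM ?posrE ?exprn_gt0// lnrt; have := ln_exp_le 6 l0; clear -l0; lra.
have ha_gt0 : 0 < 2 * l * ln a.
  by rewrite !mulr_gt0//; apply: lt_le_trans lna_ge; rewrite divr_gt0.
have h_ge : l ^+ 2 <= h%:R.
  rewrite hE; apply: le_trans (absz_ceil_ge ha_gt0).
  have -> : l ^+ 2 = 2 * l * (l / 2) by field.
  by rewrite ler_pM2l ?mulr_gt0.
have sq_ge1 : 1 <= l ^+ 2 by rewrite expr_ge1// ltW.
have h_le : h%:R <= l ^+ 3.
  rewrite hE; apply: le_trans (absz_ceil_le ha_gt0) _.
  have : 2 * l * ln a <= 2 * l * (7 * l) by rewrite ler_pM2l ?mulr_gt0.
  have : 100 * l ^+ 2 <= l ^+ 3 by rewrite [leRHS]exprS ler_wpM2r// ltW//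
    (lt_le_trans ltr01).
  have -> : 2 * l * (7 * l) = 14 * l ^+ 2 by ring.
  by clear -sq_ge1; lra.
have h_gt0 : (0 < h)%N.
  by rewrite -(ltr_nat R); apply: lt_le_trans h_ge; rewrite exprn_gt0.
have pow_le : (1 - gamma) ^+ m <= (c1 * rt)^-1.
  apply: le_trans (onem_exp_le _ _) _; first by apply/andP; split; clear -g0 g1; lra.
  have <- : expR (- ln (c1 * rt)) = (c1 * rt)^-1 by rewrite expRN lnK// posrE mulr_gt0.
  rewrite ler_expR lerN2.
  rewrite lnM ?posrE// lnrt.
  have : gamma * am <= gamma * m%:R by rewrite ler_pM2l.
  by rewrite /am mulVKf ?lt0r_neq0.
split => //; split.
- apply: (@le_trans _ _ (gamma * l ^+ 2)); last by rewrite ler_pM2l.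
  apply: (@le_trans _ _ (2 * (2 * l / gamma) * d%:R)).
    by rewrite ler_wpM2r// ler_pM2l.
  have -> : 2 * (2 * l / gamma) * d%:R = gamma * l * (4 * d%:R / gamma ^+ 2).
    by field; rewrite lt0r_neq0.
  by rewrite [l ^+ 2]expr2 [leRHS]mulrA ler_pM2l ?mulr_gt0.
- rewrite c3E -[leRHS]mulr1 ler_pM2l//.
  apply: (@le_trans _ _ (c3 * (c1 * rt)^-1)); first by rewrite ler_pM2l.
  rewrite ler_pdivrMr ?mulr_gt0//.
  rewrite mul1r.
  rewrite -ler_ln ?posrE ?mulr_gt0// lnM ?posrE// lnrt; clear -n1 n3' lnc3; lra.
- apply: le_trans pow_le _; rewrite invfM.
  by rewrite ler_pM2r ?invr_gt0.
Qed.

(* [l] stands for [ln T]; [s] carries the non-logarithmic factors. *)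
Definition polylog (R : realType) (l : R) k (s x : R) := 0 <= x <= l ^+ k * s.

Section Polylog.
Variables (R : realType) (l : R).
Hypothesis l_ge : 100 <= l.

Lemma polylogM k k' s s' x y : polylog l k s x -> polylog l k' s' y ->
  polylog l (k + k') (s * s') (x * y).
Proof.
move=> /andP[x0 xs] /andP[y0 ys]; rewrite /polylog mulr_ge0//= exprD mulrACA.
by rewrite ler_pM.
Qed.

Lemma polylogMr k k' s x y : polylog l k s x -> polylog l k' 1 y ->
  polylog l (k + k') s (x * y).
Proof. by move=> px py; rewrite -[s]mulr1; exact: polylogM. Qed.

Lemma polylogMl k k' s x y : polylog l k 1 x -> polylog l k' s y ->
  polylog l (k + k') s (x * y).
Proof. by move=> px py; rewrite -[s]mul1r; exact: polylogM. Qed.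

Lemma polylog_weak k k' (s x : R) : 0 <= s -> polylog l k s x -> (k <= k')%N ->
  polylog l k' s x.
Proof.
have L := l_ge.
move=> s0 /andP[x0 xs] kk; rewrite /polylog x0 /=; apply: le_trans xs _.
by apply: ler_wpM2r => //; apply: ler_weXn2l => //; lra.
Qed.

Lemma polylog_scale k (s s' x : R) : s <= s' -> polylog l k s x -> polylog l k s' x.
Proof.
have L := l_ge.
move=> ss /andP[x0 xs]; rewrite /polylog x0 /=; apply: le_trans xs _.
by apply: ler_wpM2l => //; rewrite exprn_ge0//; lra.
Qed.

(** The extra power of [l] absorbs the factor 2 of a sum, so no constants ever appear. *)
Lemma polylogD k k' (s x y : R) : 0 <= s -> polylog l k s x -> polylog l k' s y ->
  polylog l (maxn k k').+1 s (x + y).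
Proof.
move=> s0 px py; have L := l_ge.
have /andP[x0 xs] := polylog_weak s0 px (leq_maxl k k').
have /andP[y0 ys] := polylog_weak s0 py (leq_maxr k k').
rewrite /polylog addr_ge0//= exprS -mulrA.
have : 2 * (l ^+ maxn k k' * s) <= l * (l ^+ maxn k k' * s).
  by apply: ler_wpM2r; [rewrite mulr_ge0// exprn_ge0//; lra|lra].
lra.
Qed.

Lemma polylog_const c : 0 <= c -> c <= l -> polylog l 1 1 c.
Proof. by move=> c0 cl; rewrite /polylog c0 mulr1 expr1. Qed.

Lemma polylogX n k x : polylog l k 1 x -> polylog l (k * n) 1 (x ^+ n).
Proof.
move=> /andP[x0 xs]; rewrite /polylog exprn_ge0//= mulr1 exprM.
by rewrite lerXn2r ?nnegrE ?(le_trans x0 xs)//; move: xs; rewrite mulr1// => xs;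
  exact: le_trans x0 xs.
Qed.

End Polylog.

(** * Powers of the logarithm in each term of the regret *)

Section Rate.
Variables (R : realType) (l : R).
Variables (n d1 m h T : nat) (G kappa kappaB W gamma eta beta : R).
Hypotheses (l_ge : 100 <= l) (lg : gamma^-1 <= l) (lG : G <= l) (lk : kappa <= l)
  (lkB : kappaB <= l) (lW : W <= l) (ld : d1%:R <= l).
Hypotheses (T_gt0 : (0 < T)%N) (m_gt0 : (0 < m)%N) (h_gt0 : (0 < h)%N) (n_gt0 : (0 <
  n)%N).
Hypotheses (m_le : m%:R <= l ^+ 3) (h_le : h%:R <= l ^+ 3).
Hypotheses (d1_gt0 : (0 < d1)%N) (G_gt0 : 0 < G) (k_gt1 : 1 < kappa)
  (kB_gt1 : 1 < kappaB) (W_gt1 : 1 < W) (g_gt0 : 0 < gamma) (g_lt : gamma < 2 / 3).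
Hypothesis pow_le : (1 - gamma) ^+ m <= l / Num.sqrt T%:R.
Hypotheses (b_ge0 : 0 <= beta) (b_lt1 : beta < 1).
Hypothesis etaE : eta = dosc_eta gamma m h T.

Local Notation rt := (Num.sqrt T%:R : R).
(* The final bound is [n * sqrt T * N], up to powers of [ln T]. *)
Let N : R := Num.sqrt n%:R / (1 - beta).
(** The size, up to logarithms, of one loss in one round; over [T] rounds and [n] costs it sums to
    [n * rt * N]. *)
Let s : R := N / rt.

Let rt_gt0 : 0 < rt. Proof. by rewrite sqrtr_gt0 ltr0n. Qed.
Let N_ge1 : 1 <= N.
Proof.
have b0 := b_ge0; have b1 := b_lt1.
rewrite ler_pdivlMr ?subr_gt0// mul1r; apply: (@le_trans _ _ 1); first by lra.
by rewrite -[leLHS]sqrtr1 ler_wsqrtr// ler1n.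
Qed.
Let s_ge : rt^-1 <= s.
Proof. by rewrite /s ler_peMl// invr_ge0 ltW. Qed.
Let s_ge0 : 0 <= s.
Proof. by apply: le_trans s_ge; rewrite invr_ge0 ltW. Qed.

Let rt_to_s k x : polylog l k rt^-1 x -> polylog l k s x.
Proof. exact: polylog_scale. Qed.

Let pg : polylog l 1 1 gamma^-1.
Proof. by apply: polylog_const => //; rewrite invr_ge0 ltW. Qed.
Let pG : polylog l 1 1 G. Proof. by apply: polylog_const => //; exact: ltW. Qed.
Let pk : polylog l 1 1 kappa.
Proof. by apply: polylog_const => //; apply: ltW; apply: lt_trans k_gt1. Qed.
Let pkB : polylog l 1 1 kappaB.
Proof. by apply: polylog_const => //; apply: ltW; apply: lt_trans kB_gt1. Qed.
Let pW : polylog l 1 1 W.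
Proof. by apply: polylog_const => //; apply: ltW; apply: lt_trans W_gt1. Qed.
Let pnum k : (k <= 100)%N -> polylog l 1 1 k%:R.
Proof.
by move=> k100; apply: polylog_const => //; apply: le_trans l_ge; rewrite ler_nat.
Qed.
Let pm : polylog l 3 1 m%:R. Proof. by rewrite /polylog mulr1 ler0n. Qed.
Let ph : polylog l 3 1 h%:R. Proof. by rewrite /polylog mulr1 ler0n. Qed.

Let p_radius : polylog l 6 1 (radius kappa W gamma).
Proof.
have p3 := pnum (k := 3) isT.
by have := polylogMr (polylogMr (polylogMr p3 (polylogX 3 pk)) pW) pg.
Qed.

Let p_lip_u : polylog l 10 1 (lip_u m h W).
Proof. by have := polylogMr (polylogMr ph (polylogX 2 pm)) pW. Qed.

Let p_lip_x : polylog l 14 1 (lip_x m h kappa kappaB W gamma).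
Proof. by have := polylogMr (polylogMr (polylogX 2 pk) (polylogMr pkB p_lip_u)) pg. Qed.

Let Gam := grad_bound m h G kappa kappaB W gamma.

Let p_grad : polylog l 22 1 Gam.
Proof. by have := polylogMr (polylogMr pG p_radius) (polylogD l_ge ler01 p_lip_x
  p_lip_u). Qed.

Let mh2 : 1 <= m%:R * h%:R ^+ 2 :> R.
Proof. by rewrite -natrX -natrM ler1n muln_gt0 m_gt0 expn_gt0 h_gt0. Qed.

Let eta_gt0 : 0 < eta.
Proof.
have mh0 : 0 < m%:R * h%:R ^+ 2 :> R by apply: lt_le_trans mh2.
by rewrite etaE /dosc_eta divr_gt0 ?exprn_gt0// mulr_gt0.
Qed.

Let p_eta : polylog l 0 rt^-1 eta.
Proof.
have g0 := g_gt0; have g1 := g_lt.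
have mh0 : 0 < m%:R * h%:R ^+ 2 :> R by apply: lt_le_trans mh2.
rewrite /polylog (ltW eta_gt0) /= etaE /dosc_eta.
rewrite expr0 mul1r invfM mulrA ler_piMl ?invr_ge0 ?(ltW rt_gt0)//.
rewrite ler_pdivrMr// mul1r; apply: le_trans mh2.
by rewrite expr_le1//; lra.
Qed.

Let p_eta_inv : polylog l 11 rt eta^-1.
Proof.
have -> : eta^-1 = m%:R * h%:R ^+ 2 * (gamma^-1) ^+ 2 * rt.
  rewrite etaE /dosc_eta invf_div exprVn; ring.
rewrite /polylog -[X in l ^+ 11 * X]mul1r.
have prt : polylog l 0 rt rt by rewrite /polylog expr0 mul1r lexx ltW.
by have := polylogM (polylogMr (polylogMr pm (polylogX 2 ph)) (polylogX 2 pg)) prt.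
Qed.

Let delta := consensus_radius n beta eta Gam.

Let p_etaGam : polylog l 22 s (eta * Gam).
Proof. by apply: rt_to_s; by have := polylogMr p_eta p_grad. Qed.

Let p_delta : polylog l 23 s delta.
Proof.
have -> : delta = 2%:R * (eta * Gam) * N.
  by rewrite /delta /consensus_radius /N; ring.
have pN : polylog l 0 N N.
  by rewrite /polylog expr0 mul1r lexx andbT (le_trans ler01).
have -> : s = rt^-1 * N by rewrite mulrC.
by have := polylogM (polylogMl (pnum (k := 2) isT) (polylogMr p_eta p_grad)) pN.
Qed.

Let p_move : polylog l 25 s (move_bound n m h G kappa kappaB W gamma eta beta).
Proof. by have := polylogD l_ge s_ge0 p_etaGam (polylogMl (pnum (k := 2) isT)
  p_delta). Qed.

Let p_agent : polylog l 12 1 (agent_radius kappa kappaB W gamma).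
Proof.
have p1 := polylogMr (polylogMr (polylogX 2 pk) (polylogD l_ge ler01 (polylogMr pkB
  p_radius) pW)) pg.
by have := polylogD l_ge ler01 p_radius p1.
Qed.

Let p_tracking : polylog l 60 s (tracking_loss n m h G kappa kappaB W gamma eta beta).
Proof.
have pg2 : polylog l 2 1 (gamma ^+ 2)^-1 by rewrite -exprVn; by have := polylogX 2 pg.
have pk2 := polylogMl (pnum (k := 2) isT) (polylogX 2 pk).
have p1 := polylogMr (polylogMl pk2 (polylogMl (polylogMl pkB p_lip_u) p_move)) pg2.
have p2 := polylogMl p_lip_u p_move.
have p3 := polylogMl (polylogMr pG p_agent) (polylogD l_ge s_ge0 p1 p2).
by have := polylog_weak l_ge (k' := 60) s_ge0 p3 isT.
Qed.

Let p_trunc_err : polylog l 8 s (trunc_err m kappa W gamma).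
Proof.
have pw : polylog l 1 rt^-1 ((1 - gamma) ^+ m).
  by rewrite /polylog expr1 pow_le andbT exprn_ge0//; have := g_lt; lra.
by have := polylogMl (polylogMr (polylogMr (polylogX 5 pk) pW) pg) (rt_to_s pw).
Qed.

Let p_truncation : polylog l 60 s (truncation_loss m G kappa kappaB W gamma).
Proof.
have p1 := polylogMr (polylogMl (polylogX 2 pk) (polylogMl pkB p_trunc_err)) pg.
have p2 := polylogMl (polylogMr pG p_radius) (polylogD l_ge s_ge0 p1 p_trunc_err).
by have := polylog_weak l_ge (k' := 60) s_ge0 p2 isT.
Qed.

Let p_diameter : polylog l 13 1 (diameter d1 h kappa gamma).
Proof.
have p2 := pnum (k := 2) isT.
have g0 := g_gt0; have g1 := g_lt.
have psqrt k (y : R) : polylog l k 1 y -> 1 <= y -> polylog l k 1 (Num.sqrt y).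
  move=> /andP[y0 yl] y1; rewrite /polylog sqrtr_ge0 /=.
  by apply: le_trans yl; exact: sqrtr_le_self.
have pd : polylog l 1 1 d1%:R by exact: polylog_const.
have p_hd : polylog l 4 1 (Num.sqrt (h * d1)%N%:R).
  by apply: psqrt; [rewrite natrM;
    by have := polylogMr ph pd|rewrite ler1n muln_gt0 h_gt0].
have p_hg : polylog l 5 1 (Num.sqrt (2 * h%:R / gamma)).
  apply: psqrt; first by have := polylogMr (polylogMr p2 ph) pg.
  rewrite ler_pdivlMr// mul1r; have : 1 <= h%:R :> R by rewrite ler1n.
  lra.
by have := polylogMl p2 (polylogMr p_hd (polylogMl (polylogX 3 pk) p_hg)).
Qed.

(** Losses per round are of order [s]; the initial-distance term is of order [n * rt] and fits
    because [N >= 1]. Exponents add under products and grow by one under sums; 70 leaves some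
    slack. *)
Lemma regret_rate :
  T%:R * n%:R * (tracking_loss n m h G kappa kappaB W gamma eta beta
     + truncation_loss m G kappa kappaB W gamma)
    + (n%:R * diameter d1 h kappa gamma ^+ 2 / (2 * eta)
       + T%:R * n%:R * (eta * Gam ^+ 2 / 2 + 2 * Gam * delta)) <=
  l ^+ 70 * (n%:R * rt * N).
Proof.
have Tn_ge0 : 0 <= T%:R * n%:R :> R by rewrite mulr_ge0.
have TnE : T%:R * n%:R * s = n%:R * rt * N.
  rewrite /s -[X in X * n%:R](sqr_sqrtr (ler0n R T)); field.
  by rewrite lt0r_neq0.
have q_ge0 : 0 <= n%:R * rt * N by rewrite -TnE mulr_ge0.
have pTn k y : polylog l k s y -> polylog l k (n%:R * rt * N) (T%:R * n%:R * y).
  move=> /andP[y0 ys]; rewrite /polylog mulr_ge0//= -TnE.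
  by rewrite mulrCA ler_wpM2l.
have p_half : polylog l 1 1 2^-1.
  by apply: polylog_const => //; have := l_ge; lra.
have pA := pTn _ _ (polylogD l_ge s_ge0 p_tracking p_truncation).
have pB1 : polylog l 45 s (eta * Gam ^+ 2 / 2).
  apply: rt_to_s.
  by have := polylogMr (polylogMr p_eta (polylogX 2 p_grad)) p_half.
have pB2 : polylog l 46 s (2 * Gam * delta).
  by have := polylogMl (polylogMl (pnum (k := 2) isT) p_grad) p_delta.
have pB := pTn _ _ (polylogD l_ge s_ge0 pB1 pB2).
have pC : polylog l 38 (n%:R * rt * N) (n%:R * diameter d1 h kappa gamma ^+ 2 / (2 *
  eta)).
  have pn : polylog l 0 n%:R (n%:R : R) by rewrite /polylog expr0 mul1r lexx ler0n.
  apply: (@polylog_scale _ _ l_ge _ (n%:R * rt)).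
    by rewrite ler_peMr// mulr_ge0// ltW.
  have -> : n%:R * diameter d1 h kappa gamma ^+ 2 / (2 * eta) =
      n%:R * (diameter d1 h kappa gamma ^+ 2 * 2^-1 * eta^-1).
    by field; rewrite lt0r_neq0.
  by have := polylogM pn (polylogMl (polylogMr (polylogX 2 p_diameter) p_half)
    p_eta_inv).
have pE := polylogD l_ge q_ge0 pA (polylogD l_ge q_ge0 pC pB).
by have /andP[_] := polylog_weak l_ge (k' := 70) q_ge0 pE isT.
Qed.

End Rate.

Theorem theorem1 (R : realType) :
  exists p : nat,
  forall (d1 d2 : nat) (G kappa kappaB W : R),
    (0 < d1)%N -> (0 < d2)%N -> 0 < G -> 1 < kappa -> 1 < kappaB -> 1 < W ->
  exists C : R,
  forall gamma : R, 0 < gamma -> gamma < 2 / 3 ->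
  exists T0 : nat,
  forall T : nat, (T0 <= T)%N ->
  forall (m h : nat) (eta : R),
    m = dosc_m G kappaB kappa W gamma T ->
    h = dosc_h G kappaB kappa W gamma d1 T ->
    eta = dosc_eta gamma m h T ->
  forall (n : nat) (P : 'M[R]_n) (beta : R)
    (A : 'M[R]_d1) (B : 'M[R]_(d1, d2)) (w : nat -> 'cV[R]_d1)
    (f : 'I_n -> nat -> 'cV[R]_d1 * 'cV[R]_d2 -> R),
    gossip_matrix P ->
    second_singular_value P beta ->
    (* A1 *)
    spectral_norm B <= kappaB ->
    (forall t, (1 <= t)%N -> enorm (w t) <= W) ->
    (* A2 *)
    (forall i t, (1 <= t <= T)%N ->
      [/\ forall z, differentiable (f i t) z,
          convex_function setT (f i t) &
          forall (D : R) x u, enorm x <= D -> enorm u <= D ->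
            enorm (gradx (f i t) x u) <= G * D /\
            enorm (gradu (f i t) x u) <= G * D]) ->
    (* A3 *)
    diag_stable A B kappa gamma 0 ->
  forall (sigma : nat -> R) (phi : nat -> 'cV[R]_m),
    eigensystem (hankel gamma m) sigma phi ->
  forall (M : 'I_n -> nat -> params R d1 d2 h)
    (x : 'I_n -> nat -> 'cV[R]_d1) (u : 'I_n -> nat -> 'cV[R]_d2)
    (what : 'I_n -> nat -> 'cV[R]_d1),
    dosc_run eta (constraint_set kappa W gamma T A B sigma phi w) T
      A B P sigma phi w f M x u what ->
  forall j : 'I_n,
    agent_cost T f (x j) (u j)
      - inf [set policy_cost T A B w f K | K in diag_stable A B kappa gamma]
    <= C * ln T%:R ^+ p
         * (n%:R * Num.sqrt (n%:R * T%:R) / ((1 - beta) * gamma ^+ 3)).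
Proof.
(* The constant can be 1 because the threshold on [T], chosen after [gamma], absorbs all others into
   powers of [ln T]. *)
exists 70%N => d1 d2 G kappa kappaB W d1_gt0 _ G0 k1 kB1 W1; exists 1 => gamma g0 g1.
have [L0 hyper] := hyperparameters d1_gt0 G0 k1 kB1 W1 g0 g1.
exists (`|Num.ceil (expR L0)|%N) => T T0T m h eta mE hE etaE n P beta A B w f gP sP
  B_le w_le f_ok stab sigma phi eig M x u what run j.
have L0T : L0 <= ln T%:R.
  have e_le : expR L0 <= T%:R.
    by apply: le_trans (absz_ceil_ge (expR_gt0 _)) _; rewrite ler_nat.
  by rewrite -[leLHS]expRK ln_le_mono// expR_gt0.
have := hyper T L0T; rewrite /= -mE -hE.
set l := ln T%:R; move=> [[l100 lg lG lk lkB] [lW ld T_gt0 m_gt0 h_gt0] m_le h_le [hl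
  ml pl]].
have n_gt0 : (0 < n)%N by exact: leq_ltn_trans (ltn_ord j).
have [b0 b1 _] := gossip_contraction gP sP.
have eta_gt0 : 0 < eta.
  by rewrite etaE /dosc_eta divr_gt0 ?exprn_gt0// !mulr_gt0 ?exprn_gt0 ?sqrtr_gt0
    ?ltr0n.
have rate := regret_rate l100 lg lG lk lkB lW ld T_gt0 m_gt0 h_gt0 n_gt0 m_le h_le
  d1_gt0 G0 k1 kB1 W1 g0 g1 pl b0 b1 etaE.
have regret K (sK : diag_stable A B kappa gamma K) :=
  le_trans (dosc_regret d1_gt0 G0 k1 kB1 W1 g0 g1 eta_gt0 gP sP B_le w_le f_ok stab
    eig run hl ml j sK) rate.
set rhs := l ^+ 70 * _ in regret.
apply: (@le_trans _ _ rhs).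
  (* The regret bound is uniform in [K], so it passes to the infimum; the zero policy makes the set
     nonempty. *)
  rewrite lerBlDr -lerBlDl; apply: lb_le_inf;
    first by exists (policy_cost T A B w f 0), 0.
  by move=> _ [K sK <-]; have := regret K sK; rewrite lerBlDr lerBlDl addrC.
rewrite /rhs mul1r; apply: ler_wpM2l; first by rewrite exprn_ge0//; lra.
rewrite sqrtrM//.
have -> : n%:R * (Num.sqrt n%:R * Num.sqrt T%:R) / ((1 - beta) * gamma ^+ 3) =
    n%:R * Num.sqrt T%:R * (Num.sqrt n%:R / (1 - beta)) * (gamma ^+ 3)^-1.
  by rewrite invfM; ring.
(* The stated factor [gamma ^- 3] is at least 1 and enters only here. *)
apply: ler_peMr; first by rewrite !mulr_ge0 ?sqrtr_ge0// invr_ge0 subr_ge0 ltW.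
by rewrite invf_ge1 ?exprn_gt0// exprn_ile1//; lra.
Qed.
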